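(* Let $T=(T_m)_{m\in\mathbb Z}$ be an ergodic infinite measure preserving $\mathbb Z$-action of balanced finite rank, realized as a $(C,F)$-action on a $(C,F)$-space $X$ with $(C,F)$-measure $\mu$ as in the definition of balanced finite rank (so $\mu(X_0)=1$). Let $h_l:=\min_{1\le i\le k}\#F_l^i$ for each $l\ge1$. Then for arbitrary Borel subsets $A,B\subset X_0$, $$\lim_{l\to\infty}\frac{\sum_{m=0}^{h_l-1}\mu(A\cap T_mB)}{\sum_{m=0}^{h_l-1}\mu(X_0\cap T_mX_0)}=\mu(A)\mu(B),$$ i.e. $T$ is subsequence weakly rationally ergodic. Hence the ergodic transformations of balanced finite rank are non-squashable.
   Context: **$(C,F)$-construction of finite rank $\mathbb Z$-actions.** Fix $k\ge1$. Elements of $G'=\mathbb Z\times\{1,\dots,k\}$ and $G''=\{1,\dots,k\}\times\mathbb Z\times\{1,\dots,k\}$ are multiplied (when middle indices match) by $(f,i)*(i,g,l)=(f+g,l)\in G'$, $(i,c,j)*(j,c',l)=(i,c+c',l)\in G''$; $A*C$ is the set of all defined products; $g\cdot(f,i)=(g+f,i)$ for $g\in\mathbb Z$. For $A\subset G'$, $A^i=A\cap(\mathbb Z\times\{i\})$; for $C\subset G''$, $C^{i,j}=C\cap(\{i\}\times\mathbb Z\times\{j\})$. Let $F_n\subset G'$ ($n\ge0$), $C_n\subset G''$ ($n\ge1$) be finite with: (I) $F_0=\{0\}\times\{1,\dots,k\}$, $\sum_{j}\#C_n^{i,j}>1$ and $(0,i)\in F_n$ for each $i$; (II) $F_n*C_{n+1}\subset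 F_{n+1}$; (III) $F_n*\boldsymbol c\cap F_n*\boldsymbol c'=\emptyset$ for distinct $\boldsymbol c,\boldsymbol c'\in C_{n+1}$; (V) $(i,0,i)\in C_n$ for all $i$ and $n\ge 1$; and (finite rank) $F_n^i=\{0,1,\dots,\#F_n^i-1\}\times\{i\}$. Let $X_n$ be the set of $(\boldsymbol f_n,\boldsymbol c_{n+1},\dots)\in F_n\times C_{n+1}\times C_{n+2}\times\cdots$ for which all products $\boldsymbol f_n*\boldsymbol c_{n+1}*\cdots*\boldsymbol c_l$ are defined; embed $X_n$ into $X_{n+1}$ via $(\boldsymbol f_n,\boldsymbol c_{n+1},\dots)\mapsto(\boldsymbol f_n*\boldsymbol c_{n+1},\boldsymbol c_{n+2},\dots)$; $X=\bigcup_nX_n$ is the topological inductive limit. For $A\subset F_n$, $[A]_n=\{(\boldsymbol f_n,\dots)\in X_n:\boldsymbol f_n\in A\}$. The action: $T_gx=(g\cdot\boldsymbol f_n,\boldsymbol c_{n+1},\dots)$ for $x=(\boldsymbol f_n,\boldsymbol c_{n+1},\dots)\in X_n$ with $g\cdot\boldsymbol f_n\in F_n$. Put $r_n^{i,j}=\#C_n^{i,j}$. A $(C,F)$-measure is a Radon measure $\mu$ on $X$ with $\mu([A]_n)=\sum_{i=1}^k\#(A^i)\lambda_n^i$, where $\lambda_n\in\mathbb R_+^k$ and $\lambda_n=r_{n+1}\lambda_{n+1}$ for all $n\ge 0$. It is assumed that $T$ is defined $\mu$-a.e. (it then preserves $\mu$). **Exact rank at most $k$** (probability preserving transformation): there are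 sets $B_n^j$ and integers $h_n^j$ ($1\le j\le k$, $n\ge 0$) such that for each $n$ the sets $T_gB_n^j$, $0\le g<h_n^j$, $1\le j\le k$, form a partition (mod 0) of the space, every measurable set is approximated arbitrarily well as $n\to\infty$ by unions of these sets, and for some $\delta>0$ all $W_n^j=\bigsqcup_{0\le g<h_n^j}T_gB_n^j$ have measure $>\delta$. **Balanced finite rank**: an ergodic infinite measure preserving $T$ is of balanced finite rank if, for some $k\ge1$, it is isomorphic to the $(C,F)$-action of $\mathbb Z$ associated with some finite sets $F_n\subset G'$ ($n\ge0$) and $C_n\subset G''$ ($n\ge1$) satisfying (I), (II), (III), (V) and $F_n^i=\{0,1,\dots,\#F_n^i-1\}\times\{i\}$, considered on the corresponding space $X$ with a $(C,F)$-measure $\mu$ determined by vectors $(\lambda_n)_{n\ge0}$, for which (α) $\mu(X_0)=1$ and the induced transformation $(T_1)_{X_0}$ is an ergodic probability preserving transformation of exact rank at most $k$; (β) the limits $\lim_n\mu(X_0\cap[F_n^j]_n)=\delta_j>0$ exist for each $j$, and $\sum_j\delta_j=1$; (γ) the limits $\lim_n\lambda_n^i/\sum_{j=1}^k\lambda_n^j=\lim_nr_n^{i,j}/\sum_{l=1}^kr_n^{l,j}=\Lambda_i$ exist for all $i,j$, $\sum_i\Lambda_i=1$; and $\Lambda_i>0$ for each $i$. **Subsequence weak rational ergodicity**: there are increasing integers $h_n$ and a set $Y$ with $0<\mu(Y)<\infty$ such that $\frac1{a_n(Y)}\sum_{k=0}^{h_n-1}\mu(A\cap T_kB)\to\mu(A)\mu(B)$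 for all measurable $A,B\subset Y$, where $a_n(Y)=\sum_{k=0}^{h_n-1}\mu(Y\cap T_kY)/\mu(Y)^2$. **Non-squashable**: every nonsingular transformation commuting with $T$ preserves $\mu$. *)

(* Defs.v *)
From HB Require Import structures.
From mathcomp Require Import all_boot all_order all_algebra.
From mathcomp Require Import generic_quotient finmap.
From mathcomp Require Import all_classical all_reals all_analysis.

Set Implicit Arguments.
Unset Strict Implicit.
Unset Printing Implicit Defensive.

Import Order.TTheory GRing.Theory Num.Theory.
Import numFieldNormedType.Exports.

Local Open Scope classical_set_scope.
Local Open Scope ring_scope.
Local Open Scope quotient_scope.

(** * Combinatorial data *)

(* The index set {1, ..., k} is 'I_k. *)
Notation G' k := (int * 'I_k)%type.
Notation G'' k := ('I_k * int * 'I_k)%type.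

(* The partial product G' x G'' -> G'; [None] when the indices do not match. *)
Definition pmul k (f : G' k) (c : G'' k) : option (G' k) :=
  if f.2 == c.1.1 then Some (f.1 + c.1.2, c.2) else None.

Definition translate k (g : int) (f : G' k) : G' k := (g + f.1, f.2).

Definition prod_set k (A : set (G' k)) (B : set (G'' k)) : set (G' k) :=
  [set x | exists f c, [/\ A f, B c & pmul f c = Some x]].

Definition Fslice k (A : {fset G' k}) (i : 'I_k) : {fset G' k} :=
  [fset f in A | f.2 == i]%fset.

Definition Cslice k (A : {fset G'' k}) (i j : 'I_k) : {fset G'' k} :=
  [fset c in A | (c.1.1 == i) && (c.2 == j)]%fset.

(* The value [CF_C 0] plays no role. *)
Record CF_data (k : nat) := CFData {
  CF_F : nat -> {fset G' k};
  CF_C : nat -> {fset G'' k};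
  CF_k_gt0 : (0 < k)%N;
  CF_F0 : forall (g : int) (i : 'I_k), ((g, i) \in CF_F 0) = (g == 0);
  CF_card : forall n (i : 'I_k), (0 < n)%N ->
    (1 < \sum_(j < k) #|` Cslice (CF_C n) i j|)%N;
  CF_zeroF : forall n (i : 'I_k), ((0 : int), i) \in CF_F n;
  CF_incl : forall n,
    prod_set [set` CF_F n] [set` CF_C n.+1] `<=` [set` CF_F n.+1];
  CF_disj : forall n c c', c \in CF_C n.+1 -> c' \in CF_C n.+1 -> c != c' ->
    prod_set [set` CF_F n] [set c] `&` prod_set [set` CF_F n] [set c'] = set0;
  CF_zeroC : forall n (i : 'I_k), (0 < n)%N -> (i, (0 : int), i) \in CF_C n;
  CF_finite_rank : forall n (i : 'I_k) (g : int),
    ((g, i) \in CF_F n) = (0 <= g < (#|` Fslice (CF_F n) i|)%:Z)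
}.

(** * The space X *)

(* f * c 0 * ... * c (l - 1), bracketed to the left *)
Fixpoint prodn k (f : G' k) (c : nat -> G'' k) (l : nat) : option (G' k) :=
  if l is l'.+1 then obind (fun x => pmul x (c l')) (prodn f c l') else Some f.

Section space.
Context (k : nat) (D : CF_data k).

Definition seq_ambient : Type :=
  (discrete_topology (G' k) *
   prod_topology (fun _ : nat => discrete_topology (G'' k)))%type.
HB.instance Definition _ := Topological.on seq_ambient.

(* In a point (f, c) of X_n, the term c m stands for c_{n + 1 + m}. *)
Definition Xn (n : nat) : set seq_ambient :=
  [set x | [/\ x.1 \in CF_F D n, forall m, x.2 m \in CF_C D (n + m).+1
             & forall l, prodn x.1 x.2 l != None]].

(* The embedding of X_n into X_{n + 1}, see [Xn_embed]. *)
Definition embed (x : seq_ambient) : seq_ambient :=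
  (odflt x.1 (pmul x.1 (x.2 0%N)), fun m => x.2 m.+1).

Lemma prodnS (f : G' k) c l : prodn f c l.+1 =
  obind (fun x => prodn x (fun m => c m.+1) l) (pmul f (c 0%N)).
Proof.
elim: l => [|l IH]; first by rewrite /=; case: pmul.
by rewrite [LHS]/= -/(prodn f c l.+1) IH; case: pmul.
Qed.

Lemma Xn_embed n x : Xn n x -> Xn n.+1 (embed x).
Proof.
case: x => f c [/= fF cC fc].
have := fc 1%N; rewrite /embed /=; case E: (pmul f (c 0%N)) => [f'|]//= _.
split => /=.
- have : [set` CF_F D n.+1] f'; last by [].
  by apply: CF_incl; exists f, (c 0%N); split => //=; have := cC 0%N;
    rewrite addn0.
- by move=> m; rewrite addSn -addnS; exact: cC.
- by move=> l; have := fc l.+1; rewrite prodnS E.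
Qed.

(* The disjoint union of the X_n, in which two points are identified when they
   have the same image in some X_N. *)
Definition Xsum : Type := {n : nat & Xn n}.
HB.instance Definition _ := Topological.on Xsum.

Definition Xrel (x y : Xsum) : bool :=
  `[< exists i j, (tag x + i = tag y + j)%N /\
      iter i embed (set_val (tagged x)) = iter j embed (set_val (tagged y)) >].

Lemma Xrel_refl : reflexive Xrel.
Proof. by move=> x; apply/asboolP; exists 0%N, 0%N. Qed.

Lemma Xrel_sym : symmetric Xrel.
Proof.
by move=> x y; apply/asboolP/asboolP => -[i [j [e1 e2]]]; exists j, i.
Qed.

Lemma Xrel_trans : transitive Xrel.
Proof.
move=> y x z /asboolP[i [j [e1 e2]]] /asboolP[j' [l [e3 e4]]].
apply/asboolP; exists (j' + i)%N, (j + l)%N; split.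
  by rewrite (addnC j') addnA e1 addnAC e3 -addnA (addnC l).
by rewrite !iterD e2 -e4 -!iterD addnC.
Qed.

Canonical Xequiv := EquivRel Xrel Xrel_refl Xrel_sym Xrel_trans.

(* The quotient topology of the disjoint union, that is the topology of the
   inductive limit. *)
Definition CFspace : Type := {eq_quot Xequiv}.
HB.instance Definition _ :=
  Topological.copy CFspace (quotient_topology CFspace).
HB.instance Definition _ := Quotient.on CFspace.

Definition inX (n : nat) (x : Xn n) : CFspace := \pi_CFspace (existT _ n x).

(* X_n as a subset of X *)
Definition Xlevel (n : nat) : set CFspace := range (@inX n).

Definition cylinder (n : nat) (A : {fset G' k}) : set CFspace :=
  [set x | exists2 p : Xn n, (set_val p).1 \in A & x = inX p].

Lemma Xn0_point :
  Xn 0 ((0, Ordinal (CF_k_gt0 D)),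
        fun=> (Ordinal (CF_k_gt0 D), (0 : int), Ordinal (CF_k_gt0 D))).
Proof.
split=> /=; [exact: CF_zeroF | by move=> m; exact: CF_zeroC |].
move=> l; suff -> : forall i : 'I_k,
  prodn ((0 : int), i) (fun=> (i, (0 : int), i)) l = Some ((0 : int), i) by [].
by move=> i; elim: l => //= l ->; rewrite /= /pmul eqxx.
Qed.

HB.instance Definition _ := isPointed.Build CFspace
  (@inX 0 (exist (fun x => x \in Xn 0) _ (mem_set Xn0_point))).

Definition CFborel : measurableType _ := g_sigma_algebraType (@open CFspace).

(* [CFrel g x y] : T_g is defined at x and y = T_g x. *)
Definition CFrel (g : int) (x y : CFspace) : Prop :=
  exists n (p q : Xn n), [/\ x = inX p, y = inX q
    & set_val q = (translate g (set_val p).1, (set_val p).2)].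

(* T_g, extended by the identity outside of its domain *)
Definition CFact (g : int) : CFspace -> CFspace := fun_of_rel id (CFrel g).

(* h_l; the default value of the minimum is not smaller than its terms, and
   k > 0. *)
Definition min_height (l : nat) : nat :=
  \big[minn/#|` CF_F D l|]_(i < k) #|` Fslice (CF_F D l) i|.

Definition rmx (R : realType) (n : nat) : 'M[R]_k :=
  \matrix_(i, j) (#|` Cslice (CF_C D n) i j|)%:R.

End space.

Arguments Xlevel {k} D n.
Arguments cylinder {k} D n A.
Arguments CFrel {k} D g x y.
Arguments CFact {k} D g x.
Arguments rmx {k} D R n.

(** * Ergodic theory *)

Section ergodic.
Context d (Y : measurableType d) (R : realType).
Implicit Types (mu : {measure set Y -> \bar R}) (T : int -> Y -> Y)
  (S : Y -> Y) (D : set Y).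

(* The notions "_on" concern a transformation S of the measure space (D, mu)
   for a measurable subset D. *)
Definition measure_preserving_on mu D S : Prop :=
  [/\ measurable_fun D S, mu (D `\` S @^-1` D) = 0%E
    & forall A, measurable A -> A `<=` D -> mu (D `&` S @^-1` A) = mu A].

Definition ergodic_on mu D S : Prop :=
  forall A, measurable A -> A `<=` D ->
    mu (D `&` (S @^-1` A `+` A)) = 0%E -> mu A = 0%E \/ mu (D `\` A) = 0%E.

(* The first return map to A, extended by the identity to the points that do
   not return. *)
Definition induced S (A : set Y) : Y -> Y := fun_of_rel id (fun x y =>
  exists n, [/\ (0 < n)%N, y = iter n S x, A y
    & forall m, (0 < m < n)%N -> ~ A (iter m S x)]).

Definition exact_rank_at_most_on mu D S (k : nat) : Prop :=
  exists (B : nat -> 'I_k -> set Y) (h : nat -> 'I_k -> nat),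
  let level n j g := iter g S @` B n j in
  let union n (J : set ('I_k * nat)) :=
    \bigcup_(q in [set q | J q /\ (q.2 < h n q.1)%N]) level n q.1 q.2 in
  [/\ forall n j g, (g < h n j)%N ->
        measurable (level n j g) /\ level n j g `<=` D,
      forall n j g j' g', (g < h n j)%N -> (g' < h n j')%N ->
        (j, g) <> (j', g') -> mu (level n j g `&` level n j' g') = 0%E,
      forall n, mu (D `\` union n setT) = 0%E,
      forall A, measurable A -> A `<=` D -> forall e : R, 0 < e ->
        \forall n \near \oo, exists J, (mu (A `+` union n J) < e%:E)%E
    & exists2 delta : R, 0 < delta &
        forall n j, (delta%:E < mu (union n [set q | q.1 = j]))%E].

Definition measure_preserving_action mu T : Prop :=
  [/\ forall g, measurable_fun setT (T g),
      forall g A, measurable A -> mu (T g @^-1` A) = mu A,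
      \forall x \ae mu, T 0 x = x
    & forall g h, \forall x \ae mu, T (g + h) x = T g (T h x)].

Definition ergodic_infinite_mp mu T : Prop :=
  [/\ measure_preserving_action mu T, ergodic_on mu setT (T 1)
    & mu setT = +oo%E].

Definition return_sum mu T (A B : set Y) (n : nat) : R :=
  \sum_(0 <= m < n) fine (mu (A `&` T m%:Z @` B)).

Definition subseq_weakly_rationally_ergodic mu T : Prop :=
  exists (h : nat -> nat) (Z : set Y),
  let a n := return_sum mu T Z Z (h n) / fine (mu Z) ^+ 2 in
  [/\ {homo h : m n / (m < n)%N}, measurable Z, (0 < mu Z < +oo)%E
    & forall A B, measurable A -> measurable B -> A `<=` Z -> B `<=` Z ->
      (fun n => (a n)^-1 * return_sum mu T A B (h n)) @ \oo -->
        fine (mu A) * fine (mu B)].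

(* S is not required to be invertible. *)
Definition nonsingular mu S : Prop :=
  measurable_fun setT S /\
  forall A, measurable A -> (mu (S @^-1` A) = 0%E <-> mu A = 0%E).

Definition non_squashable mu T : Prop :=
  forall S, nonsingular mu S ->
    (forall g, \forall x \ae mu, S (T g x) = T g (S x)) ->
    forall A, measurable A -> mu (S @^-1` A) = mu A.

End ergodic.

(* Isomorphism mod 0 of measure preserving actions *)
Definition isomorphic_actions (R : realType) d (Y : measurableType d)
    (nu : {measure set Y -> \bar R}) (T : int -> Y -> Y)
    d' (Y' : measurableType d') (nu' : {measure set Y' -> \bar R})
    (T' : int -> Y' -> Y') : Prop :=
  exists (phi : Y -> Y') (psi : Y' -> Y),
  [/\ measurable_fun setT phi /\ measurable_fun setT psi,
      \forall y \ae nu, psi (phi y) = y,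
      \forall y \ae nu', phi (psi y) = y,
      forall A, measurable A -> nu (phi @^-1` A) = nu' A
    & forall g, \forall y \ae nu, phi (T g y) = T' g (phi y)].

(** * (C,F)-measures and balanced finite rank *)

Section balanced.
Context (R : realType) (k : nat) (D : CF_data k).
Implicit Types (mu : {measure set (CFborel D) -> \bar R})
  (lambda : nat -> 'cV[R]_k).

(* locally finite and inner regular *)
Definition radon mu : Prop :=
  (forall x : CFspace D, exists U : set (CFspace D),
    [/\ open U, U x & (mu U < +oo)%E]) /\
  (forall A : set (CFborel D), measurable A ->
    mu A = ereal_sup [set mu K | K in
      [set K : set (CFspace D) | compact K /\ K `<=` A]]).

Definition CF_measure mu lambda : Prop :=
  [/\ radon mu,
      forall n i, 0 <= lambda n i ord0,
      forall n, lambda n = rmx D R n.+1 *m lambda n.+1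
    & forall n (A : {fset G' k}), (A `<=` CF_F D n)%fset ->
      mu (cylinder D n A) =
        (\sum_(i < k) (#|` Fslice A i|)%:R * lambda n i ord0)%:E].

Definition CF_defined_ae mu : Prop :=
  forall g, \forall x \ae mu, exists y, CFrel D g x y.

Definition balanced_CF mu lambda : Prop :=
  let X0 := Xlevel D 0 in
  let S := @induced _ (CFborel D) (CFact D 1) X0 in
  [/\ CF_measure mu lambda,
      CF_defined_ae mu,
      [/\ mu X0 = 1%E, measure_preserving_on mu X0 S, ergodic_on mu X0 S
        & exact_rank_at_most_on mu X0 S k],
      (exists delta : 'I_k -> R,
        (forall j, 0 < delta j /\
          (fun n => mu (X0 `&` cylinder D n (Fslice (CF_F D n) j)))
            @ \oo --> (delta j)%:E) /\
        \sum_(j < k) delta j = 1)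
    & exists Lambda : 'I_k -> R,
        [/\ forall i, (fun n => lambda n i ord0 /
              \sum_(j < k) lambda n j ord0) @ \oo --> Lambda i,
            forall i j, (fun n => rmx D R n i j /
              \sum_(l < k) rmx D R n l j) @ \oo --> Lambda i,
            \sum_(i < k) Lambda i = 1
          & forall i, 0 < Lambda i]].

End balanced.

Definition balanced_finite_rank (R : realType) d (Y : measurableType d)
    (nu : {measure set Y -> \bar R}) (T : int -> Y -> Y) : Prop :=
  exists (k : nat) (D : CF_data k) (mu : {measure set (CFborel D) -> \bar R})
    (lambda : nat -> 'cV[R]_k),
    balanced_CF mu lambda /\ isomorphic_actions nu T mu (CFact D).

(* Main.v *)
(* Write N_i for the number of levels of the i-th tower of level l contained in
   X_0, h for the height of the shortest tower, a_l for the sum over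
   0 <= m < h of mu(X_0 /\ T_m X_0).  An orbit segment of length h meets at most
   two towers, hence visits X_0 at most 2 max N_i times.  Counting the pairs of
   levels of the shortest tower gives a_l >= lambda_i N_i ^ 2 / 2 for that tower.
   Since N_i lambda_i and lambda_i / sum_j lambda_j have positive limits, the
   number of visits is at most M a_l for a constant M; moreover a_l -> oo, as
   lambda -> 0.

   Consequently u_l(x) = #{m < h : T_m x in B} / a_l, for B in X_0, is bounded
   by M almost everywhere on the whole of X and satisfies
   |u_l(T_1 x) - u_l(x)| <= 1 / a_l.  If f, g >= 0 have the same integral, then f
   can be cut into pieces whose translates make up g, up to arbitrarily small
   remainders: for each j in turn move min(f, g o T_j) along T_j; by ergodicity
   nothing is left in the limit.  Hence int f u_l - int g u_l -> 0.  Applied to T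
   and to its inverse, this gives int f u_l -> mu(B) int f, and f = 1_A is the
   first claim.

   Let S be nonsingular and commute with T, let A lie in X_0 and E = S^-1 A.  With
   f the density of the image under S of the restriction of mu to X_0, the limit
   above shows that the average number of visits of X_0 to E, divided by a_l,
   tends to mu(A); reversing time, it tends to mu(E).  Hence mu(E) = mu(A). *)

From HB Require Import structures.
Require Import Defs.
From mathcomp Require Import all_boot all_order all_algebra.
From mathcomp Require Import finmap.
From mathcomp Require Import all_classical all_reals all_analysis.
From mathcomp Require Import measurable_realfun.
From mathcomp Require Import ring lra zify.

Import Order.TTheory GRing.Theory Num.Theory.
Import numFieldNormedType.Exports.

Local Open Scope classical_set_scope.
Local Open Scope ring_scope.

Set Implicit Arguments.
Unset Strict Implicit.
Unset Printing Implicit Defensive.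

(** * Almost invariant functions are equidistributed *)

(** The identities of an action are required at every point, so that orbits can be followed without
    exceptional sets. [exact_version] provides such a representative of an action given almost
    everywhere. *)
Definition exact_action (R : realType) d (Y : measurableType d)
    (mu : {measure set Y -> \bar R}) (T : int -> Y -> Y) : Prop :=
  [/\ forall x, T 0 x = x,
      forall g h x, T (g + h) x = T g (T h x),
      forall g, measurable_fun setT (T g)
    & forall g A, measurable A -> mu (T g @^-1` A) = mu A].

Lemma exact_action_opp (R : realType) d (Y : measurableType d)
    (mu : {measure set Y -> \bar R}) (T : int -> Y -> Y) :
  exact_action mu T -> exact_action mu (fun g => T (- g)).
Proof.
move=> [T0 TD mT pT]; split => //.
- by move=> g h x; rewrite opprD TD.
- by move=> g A mA; exact: pT.
Qed.

Section matching.
Context (R : realType) d (Y : measurableType d)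
  (mu : {measure set Y -> \bar R}) (T : int -> Y -> Y).
Context (actT : exact_action mu T) (ergT : ergodic_on mu setT (T 1)).

Let T0 x : T 0 x = x. Proof. by case: actT. Qed.
Let TD g h x : T (g + h) x = T g (T h x). Proof. by case: actT. Qed.
Let mT g : measurable_fun setT (T g). Proof. by case: actT. Qed.
Let pT g A : measurable A -> mu (T g @^-1` A) = mu A.
Proof. by case: actT => _ _ _; exact. Qed.

Let TK g x : T (- g) (T g x) = x. Proof. by rewrite -TD addNr T0. Qed.
Let TKV g x : T g (T (- g) x) = x. Proof. by rewrite -TD addrN T0. Qed.

Let mTpre g A : measurable A -> measurable (T g @^-1` A).
Proof. by move=> mA; rewrite -[X in measurable X]setTI; exact: mT. Qed.

Lemma ge0_integral_act (g : int) (f : Y -> \bar R) : measurable_fun setT f ->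
  (forall x, (0 <= f x)%E) -> (\int[mu]_x f (T g x) = \int[mu]_x f x)%E.
Proof.
move=> mf f0.
have := @ge0_integral_pushforward _ _ _ _ _ _ (mT g) mu setT f measurableT mf.
rewrite preimage_setT => <- //.
by apply: eq_measure_integral => A mA _; exact: pT.
Qed.

Lemma integrable_act (g : int) (f : Y -> R) : mu.-integrable setT (EFin \o f) ->
  mu.-integrable setT (EFin \o (f \o T g)).
Proof.
move=> /integrableP[mf fi]; apply/integrableP; split.
  exact: (measurableT_comp mf (mT g)).
rewrite (@ge0_integral_act g (fun x => `|(f x)%:E|)%E)//.
exact: measurableT_comp.
Qed.

Lemma Rintegral_act (g : int) (f : Y -> R) : mu.-integrable setT (EFin \o f) ->
  \int[mu]_x f (T g x) = \int[mu]_x f x.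
Proof.
move=> fi; have /integrableP[mf _] := fi.
rewrite /Rintegral; congr fine.
rewrite [in LHS]integralE [in RHS]integralE.
congr (_ - _)%E.
  rewrite -/((EFin \o f) \o T g) funepos_comp.
  exact: (@ge0_integral_act g _ (measurable_funepos mf) (funepos_ge0 _)).
rewrite -/((EFin \o f) \o T g) funeneg_comp.
exact: (@ge0_integral_act g _ (measurable_funeneg mf) (funeneg_ge0 _)).
Qed.

(* Transports mass from [fg.1] to [fg.2] along [T j], as much as possible. *)
Definition transported (j : int) (fg : (Y -> R) * (Y -> R)) (x : Y) : R :=
  Num.min (fg.1 x) (fg.2 (T j x)).

(** The two components are the mass still to be sent and the mass still to be received. What leaves
    [x] arrives at [T j x], hence the shift by [- j] in the second component. *)
Definition match_step (j : int) (fg : (Y -> R) * (Y -> R)) :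
    (Y -> R) * (Y -> R) :=
  (fun x => fg.1 x - transported j fg x,
   fun x => fg.2 x - transported j fg (T (- j) x)).

Definition l1pos (f : Y -> R) :=
  (forall x, 0 <= f x) /\ mu.-integrable setT (EFin \o f).

Lemma l1pos_measurable f : l1pos f -> measurable_fun setT f.
Proof. by move=> [_ /measurable_int/measurable_EFinP]. Qed.

Lemma l1pos_transported j fg : l1pos fg.1 -> l1pos fg.2 ->
  l1pos (transported j fg).
Proof.
move=> f1 f2; split.
  by move=> x; rewrite le_min; apply/andP; split; [exact: f1.1|exact: f2.1].
apply: le_integrable f1.2 => //=.
  apply/measurable_EFinP/measurable_minr; first exact: l1pos_measurable.
  exact: (measurableT_comp (l1pos_measurable f2) (mT j)).
move=> x _; rewrite lee_fin ger0_norm; last first.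
  by rewrite le_min; apply/andP; split; [exact: f1.1|exact: f2.1].
by rewrite ger0_norm ?ge_min ?lexx//; exact: f1.1.
Qed.

Lemma l1pos_match_step j fg : l1pos fg.1 -> l1pos fg.2 ->
  l1pos (match_step j fg).1 /\ l1pos (match_step j fg).2.
Proof.
move=> f1 f2; have [p0 pi] := l1pos_transported j f1 f2.
split; split => /=.
- by move=> x; rewrite subr_ge0 ge_min lexx.
- exact: (integrableB measurableT f1.2 pi).
- by move=> x; rewrite subr_ge0 /transported TKV ge_min lexx orbT.
- exact: (integrableB measurableT f2.2 (integrable_act (- j) pi)).
Qed.

Lemma match_step_le j fg x : l1pos fg.1 -> l1pos fg.2 ->
  (match_step j fg).1 x <= fg.1 x /\ (match_step j fg).2 x <= fg.2 x.
Proof.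
move=> f1 f2; have [p0 pi] := l1pos_transported j f1 f2.
by rewrite /= !gerBl.
Qed.

Lemma match_step_integral j fg : l1pos fg.1 -> l1pos fg.2 ->
  \int[mu]_x fg.1 x - \int[mu]_x fg.2 x =
  \int[mu]_x (match_step j fg).1 x - \int[mu]_x (match_step j fg).2 x.
Proof.
move=> f1 f2; have [p0 pi] := l1pos_transported j f1 f2.
rewrite /= RintegralB//; [|by case: f1].
rewrite RintegralB//; [|by case: f2|exact: (integrable_act (- j) pi)].
by rewrite (Rintegral_act (- j) pi); ring.
Qed.

(** The smaller of the two masses is used up completely, so one of the two remainders vanishes. *)
Lemma match_step_min j fg x :
  Num.min ((match_step j fg).1 x) ((match_step j fg).2 (T j x)) = 0.
Proof.
rewrite /= TK /transported.
by case: (leP (fg.1 x) (fg.2 (T j x))) => h; rewrite subrr;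
  [rewrite min_l ?subr_ge0|rewrite min_r// subr_ge0 ltW].
Qed.

(** The steps run through an enumeration of the integers, with 0 where [unpickle] fails. One use of
    each [j], at step [pickle j], is enough because the remainders never increase. *)
Fixpoint matching (fg : (Y -> R) * (Y -> R)) n : (Y -> R) * (Y -> R) :=
  if n is n'.+1 then match_step (odflt (0 : int) (choice.unpickle n')) (matching fg n')
  else fg.

Context (f g : Y -> R) (f1 : l1pos f) (g1 : l1pos g).
Context (fg_int : \int[mu]_x f x = \int[mu]_x g x).
Let st := matching (f, g).

Lemma l1pos_matching n : l1pos (st n).1 /\ l1pos (st n).2.
Proof. by elim: n => // n [? ?]; exact: l1pos_match_step. Qed.

Let st1 n := (l1pos_matching n).1.
Let st2 n := (l1pos_matching n).2.

Lemma matching_integral n : \int[mu]_x (st n).1 x = \int[mu]_x (st n).2 x.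
Proof.
elim: n => // n IH; apply/eqP; rewrite -subr_eq0.
by rewrite -match_step_integral// -/st IH subrr.
Qed.

Lemma matching_nonincreasing x : nonincreasing_seq (fun n => (st n).1 x) /\
  nonincreasing_seq (fun n => (st n).2 x).
Proof.
split; apply/nonincreasing_seqP => n;
  by have [] := match_step_le (odflt (0 : int) (choice.unpickle n)) x (st1 n) (st2 n).
Qed.

Let finf x := limn (fun n => (st n).1 x).
Let ginf x := limn (fun n => (st n).2 x).

Let cvg_f x : (fun n => (st n).1 x) @ \oo --> finf x.
Proof.
apply: nonincreasing_is_cvgn; first exact: (matching_nonincreasing x).1.
by exists 0 => _ [n _ <-]; exact: (st1 n).1.
Qed.

Let cvg_g x : (fun n => (st n).2 x) @ \oo --> ginf x.
Proof.
apply: nonincreasing_is_cvgn; first exact: (matching_nonincreasing x).2.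
by exists 0 => _ [n _ <-]; exact: (st2 n).1.
Qed.

Let finf_ge0 x : 0 <= finf x.
Proof.
by apply: limr_ge; [exact: cvg_f|apply: nearW => n; exact: (st1 n).1].
Qed.

Let ginf_ge0 x : 0 <= ginf x.
Proof.
by apply: limr_ge; [exact: cvg_g|apply: nearW => n; exact: (st2 n).1].
Qed.

(** The minimum is already 0 right after step [pickle j], and the limits lie below the remainders at
    that step. *)
Let minf j x : Num.min (finf x) (ginf (T j x)) = 0.
Proof.
apply: le_anti; apply/andP; split; last first.
  by rewrite le_min finf_ge0 ginf_ge0.
rewrite -(match_step_min j (st (choice.pickle j)) x) le_min; apply/andP; split.
  rewrite ge_min; apply/orP; left.
  have cfx : cvgn (fun n => (st n).1 x) by exact: cvg_f.
  have := nonincreasing_cvgn_ge (matching_nonincreasing x).1 cfx.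
  by move=> /(_ (choice.pickle j).+1); rewrite /st /= choice.pickleK.
rewrite ge_min; apply/orP; right.
have cgx : cvgn (fun n => (st n).2 (T j x)) by exact: cvg_g.
have := nonincreasing_cvgn_ge (matching_nonincreasing (T j x)).2 cgx.
by move=> /(_ (choice.pickle j).+1); rewrite /st /= choice.pickleK.
Qed.

Let mfinf : measurable_fun setT finf.
Proof.
apply: (@measurable_fun_cvg _ _ _ setT (fun n => (st n).1)) => //.
by move=> n; exact: l1pos_measurable.
Qed.

Let mginf : measurable_fun setT ginf.
Proof.
apply: (@measurable_fun_cvg _ _ _ setT (fun n => (st n).2)) => //.
by move=> n; exact: l1pos_measurable.
Qed.

(** The set of points whose orbit meets [Q] is invariant, hence null or conull by ergodicity; as it
    contains [Q], it is conull. *)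
Lemma orbit_saturation (Q : set Y) : measurable Q -> mu Q != 0%E ->
  mu (~` \bigcup_(n : nat) (T (odflt (0 : int) (choice.unpickle n)) @^-1` Q)) = 0%E.
Proof.
move=> mQ Q0; set U := \bigcup_n _.
have mU : measurable U by apply: bigcup_measurable => n _; exact: mTpre.
have UT x : U x <-> exists j, Q (T j x).
  split=> [[n _ Qx]|[j Qx]]; first by eexists; exact: Qx.
  by exists (choice.pickle j) => //; rewrite /preimage /= choice.pickleK.
have [] := ergT mU (@subsetT _ _).
- rewrite (_ : T 1 @^-1` U `+` U = set0) ?setI0 ?measure0//.
  apply/seteqP; split => // x [[/UT[j Qj]]|[/UT[j Qj]]] nU; apply: nU; apply/UT.
    by exists (j + 1); rewrite TD.
  by exists (j - 1); rewrite -TD subrK.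
- move=> U0; exfalso; move/eqP: Q0; apply.
  apply/eqP; rewrite -measure_le0 -U0; apply: le_measure; rewrite ?inE//.
  by move=> x Qx; apply/UT; exists 0; rewrite T0.
- by rewrite setTD.
Qed.

(** Dominated convergence, with the first function as the dominating one. *)
Let int_cvg0 (h : Y -> R) (h_ : nat -> Y -> R) :
  (forall n, l1pos (h_ n)) -> (forall x, nonincreasing_seq (h_ ^~ x)) ->
  measurable_fun setT h -> (forall x, h_ ^~ x @ \oo --> h x) ->
  (forall x, 0 <= h x) -> mu [set x | 0 < h x] = 0%E ->
  (fun n => \int[mu]_x h_ n x) @ \oo --> (0 : R).
Proof.
move=> hn hd mh hc hge hz.
have mhn n : measurable_fun setT (EFin \o h_ n).
  by apply/measurable_EFinP; exact: l1pos_measurable.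
have mh' : measurable_fun setT (EFin \o h) by exact/measurable_EFinP.
have hc' : {ae mu, forall x, setT x -> (EFin \o h_ n) x @[n --> \oo] --> (EFin \o h) x}.
  by apply: aeW => x _; apply: cvg_EFin; [exact: nearW|exact: hc].
have hb : {ae mu, forall x n, setT x -> (`|(EFin \o h_ n) x| <= (EFin \o h_ 0%N) x)%E}.
  apply: aeW => x n _ /=; rewrite lee_fin ger0_norm ?(hn n).1//.
  exact: (hd x 0%N n).
have [_ _] := dominated_convergence measurableT mhn mh' hc' (hn 0%N).2 hb.
rewrite (_ : (\int[mu]_x (EFin \o h) x)%E = 0%E); last first.
  have -> : (\int[mu]_x (EFin \o h) x = \int[mu]_x `|(EFin \o h) x|)%E.
    by apply: eq_integral => x _; rewrite /= ger0_norm.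
  apply/ae_eq_integral_abs => //; exists [set x | 0 < h x]; split => //.
    have := mh measurableT `]0, +oo[%classic.
    rewrite setTI => /(_ (measurable_itv _)); congr measurable.
    by apply/seteqP; split => x /=; rewrite in_itv /= andbT.
  move=> x /= /not_implyP[_ /eqP]; rewrite eqe => hx.
  by rewrite lt_def hx hge.
by move=> /fine_cvg.
Qed.

(** If the limit of the second remainders vanishes almost everywhere, their integrals tend to 0, and
    they equal those of the first remainders. Otherwise almost every orbit meets the set where
    [ginf] is positive, and [minf] forces [finf] to vanish at all points of such orbits. *)
Lemma matching_cvg0 : (fun n => \int[mu]_x (st n).1 x) @ \oo --> (0 : R).
Proof.
have mpos (h : Y -> R) : measurable_fun setT h -> measurable [set x | 0 < h x].
  move=> /(_ measurableT `]0, +oo[%classic).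
  rewrite setTI => /(_ (measurable_itv _)); congr measurable.
  by apply/seteqP; split => x /=; rewrite in_itv /= andbT.
have [Q0|Q0] := eqVneq (mu [set x | 0 < ginf x]) 0%E.
  rewrite (_ : (fun n => _) = (fun n => \int[mu]_x (st n).2 x)).
    apply: int_cvg0 Q0 => // x.
    exact: (matching_nonincreasing x).2.
  by apply/funext => n; exact: matching_integral.
have P0 := orbit_saturation (mpos _ mginf) Q0.
apply: (@int_cvg0 finf) => // [x|]; first exact: (matching_nonincreasing x).1.
apply/eqP; rewrite -measure_le0 -P0; apply: le_measure; rewrite ?inE.
- exact: mpos.
- apply: measurableC; apply: bigcup_measurable => n _; apply: mTpre.
  exact: mpos.
- move=> x /= fx [n _ /= gx].
  have := minf (odflt (0 : int) (choice.unpickle n)) x.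
  by apply/eqP; rewrite gt_eqF// lt_min fx.
Qed.

End matching.

Section ae_integral.
Context (R : realType) d (Y : measurableType d) (mu : {measure set Y -> \bar R}).

Lemma ae_le_Rintegral (f g : Y -> R) : l1pos mu f -> l1pos mu g ->
  (\forall x \ae mu, f x <= g x) -> \int[mu]_x f x <= \int[mu]_x g x.
Proof.
move=> f1 g1 fg; rewrite /Rintegral fine_le//.
- exact: integrable_fin_num f1.2.
- exact: integrable_fin_num g1.2.
apply: ae_ge0_le_integral => //.
- by move=> x _; rewrite lee_fin f1.1.
- by apply/measurable_EFinP; exact: l1pos_measurable f1.
- by move=> x _; rewrite lee_fin g1.1.
- by apply/measurable_EFinP; exact: l1pos_measurable g1.
- by apply: filterS fg => x fgx _; rewrite lee_fin.
Qed.

Lemma l1pos_mul_bounded (f u : Y -> R) K : l1pos mu f -> measurable_fun setT u ->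
  (forall x, 0 <= u x <= K) -> l1pos mu (fun x => f x * u x).
Proof.
move=> f1 mu_ u0; split.
  by move=> x; rewrite mulr_ge0 ?f1.1//; case/andP: (u0 x).
have ub : [bounded u x | x in [set: Y]].
  exists K; split; first exact: num_real.
  move=> r Kr x _ /=; case/andP: (u0 x) => ? ?; rewrite ger0_norm//.
  by apply: le_trans (ltW Kr).
exact: (integrableMl measurableT f1.2 mu_ ub).
Qed.

Lemma l1pos_indic (A : set Y) : measurable A -> (mu A < +oo)%E ->
  l1pos mu (\1_A : Y -> R).
Proof.
move=> mA Aoo; split; first by move=> x; rewrite indicE ler0n.
apply/integrableP; split.
  by apply/measurable_EFinP; exact: measurable_indic.
rewrite (eq_integral (fun x => (\1_A x)%:E)); last first.
  by move=> t _; rewrite gee0_abs// lee_fin indicE ler0n.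
by rewrite integral_indic// setIT.
Qed.

Lemma Rintegral_indic (A : set Y) : measurable A ->
  \int[mu]_x (\1_A x : R) = fine (mu A).
Proof. by move=> mA; rewrite /Rintegral integral_indic// setIT. Qed.

Lemma l1posZ (f : Y -> R) c : 0 <= c -> l1pos mu f ->
  l1pos mu (fun x => c * f x).
Proof.
move=> c0 f1; split; first by move=> x; rewrite mulr_ge0 ?f1.1.
by have := integrableZl measurableT c f1.2.
Qed.

End ae_integral.

Section equidistribution.
Context (R : realType) d (Y : measurableType d)
  (mu : {measure set Y -> \bar R}) (T : int -> Y -> Y).
Context (actT : exact_action mu T) (ergT : ergodic_on mu setT (T 1)).
Context (u : nat -> Y -> R) (K e : nat -> R) (M : R).
Context (mu_ : forall l, measurable_fun setT (u l))
  (uK : forall l x, 0 <= u l x <= K l)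
  (uM : \forall l \near \oo, \forall x \ae mu, u l x <= M)
  (ue : forall l x, `|u l (T 1 x) - u l x| <= e l)
  (e0 : e @ \oo --> (0 : R)).

Lemma almost_invariant_pos l (n : nat) x : `|u l (T n%:Z x) - u l x| <= e l *+ n.
Proof.
have [T0 TD _ _] := actT.
elim: n => [|n IH]; first by rewrite T0 subrr normr0 mulr0n.
rewrite mulrS -(subrKA (u l (T n%:Z x))); apply: le_trans (ler_normD _ _) _.
by apply: lerD => //; rewrite -addn1 PoszD (addrC n%:Z) TD; exact: ue.
Qed.

Lemma almost_invariant l (j : int) x : `|u l (T j x) - u l x| <= e l *+ `|j|%N.
Proof.
have [T0 TD _ _] := actT.
case: (intP j) => [|n|n]; first by rewrite T0 subrr normr0 mulr0n.
  exact: almost_invariant_pos.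
have := almost_invariant_pos l n.+1 (T (- n.+1%:Z) x).
by rewrite -TD addrN T0 distrC abszN.
Qed.

(** By invariance, moving [p] along [T j] amounts to replacing [u l] by [u l \o T j], which costs at
    most [e l] times [|j|] times the integral of [p]. *)
Lemma transported_cvg0 (j : int) (p : Y -> R) : l1pos mu p ->
  (fun l => \int[mu]_x (p x * u l x) - \int[mu]_x (p (T (- j) x) * u l x))
    @ \oo --> (0 : R).
Proof.
move=> p1; have [T0 TD mT pT] := actT.
have puI l : l1pos mu (fun x => p x * u l x).
  by apply: l1pos_mul_bounded (uK l).
have puTI l : l1pos mu (fun x => p x * u l (T j x)).
  apply: (@l1pos_mul_bounded _ _ _ _ _ (u l \o T j) (K l)) => //.
    exact: measurableT_comp.
  by move=> x; exact: uK.
have E l : \int[mu]_x (p x * u l x) - \int[mu]_x (p (T (- j) x) * u l x) =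
    \int[mu]_x (p x * u l x - p x * u l (T j x)).
  rewrite RintegralB//; [|exact: (puI l).2|exact: (puTI l).2].
  congr (_ - _).
  have pTu : l1pos mu (fun x => p (T (- j) x) * u l x).
    apply: (l1pos_mul_bounded _ _ (uK l)) => //; split.
      by move=> x; exact: p1.1.
    exact: (integrable_act actT (- j) p1.2).
  rewrite -(Rintegral_act actT j pTu.2).
  by apply: eq_Rintegral => x _; rewrite -TD addNr T0.
apply/cvgr0Pnorm_le => eps eps0.
have e0' : (fun l => e l *+ `|j|%N * \int[mu]_x p x) @ \oo --> (0 : R).
  rewrite -(mul0r (\int[mu]_x p x)) -(mul0rn _ `|j|%N).
  by apply: cvgM; [exact: cvgMn|exact: cvg_cst].
move/cvgr0Pnorm_le: e0' => /(_ eps eps0); apply: filterS => l hl.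
rewrite E; apply: le_trans hl; apply: le_trans (ler_norm _).
have pBI := integrableB measurableT (puI l).2 (puTI l).2.
apply: le_trans (le_normr_Rintegral measurableT pBI) _.
have p2 : mu.-integrable setT (EFin \o (fun x => e l *+ `|j|%N * p x)).
  exact: (integrableZl measurableT _ p1.2).
rewrite -RintegralZl//; last exact: p1.2.
apply: le_Rintegral => //; first exact: (integrable_norm pBI).
move=> x _; rewrite -mulrBr normrM ger0_norm ?p1.1// mulrC ler_wpM2r ?p1.1//.
by rewrite distrC; exact: almost_invariant.
Qed.

(** A step removes some [p] from the first function and [p \o T (- j)] from the second, so the
    difference of the two integrals changes by a quantity covered by [transported_cvg0]. *)
Lemma matching_step_cvg (f g : Y -> R) n : l1pos mu f -> l1pos mu g ->
  (fun l => (\int[mu]_x (f x * u l x) - \int[mu]_x (g x * u l x)) -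
    (\int[mu]_x ((matching T (f, g) n).1 x * u l x) -
     \int[mu]_x ((matching T (f, g) n).2 x * u l x))) @ \oo --> (0 : R).
Proof.
move=> f1 g1; elim: n => [|n IH].
  by under eq_fun do rewrite subrr; exact: cvg_cst.
have [m1 m2] := l1pos_matching actT f1 g1 n.
set j := odflt (0 : int) (choice.unpickle n).
have p1 := l1pos_transported actT j m1 m2.
have pT1 : l1pos mu (transported T j (matching T (f, g) n) \o T (- j)).
  by split; [move=> x; exact: p1.1|exact: (integrable_act actT (- j) p1.2)].
have mul1 h l : l1pos mu h -> mu.-integrable setT (EFin \o (fun x => h x * u l x)).
  by move=> h1; have [] := l1pos_mul_bounded h1 (mu_ l) (uK l).
have E l : (\int[mu]_x (f x * u l x) - \int[mu]_x (g x * u l x)) -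
    (\int[mu]_x ((matching T (f, g) n.+1).1 x * u l x) -
     \int[mu]_x ((matching T (f, g) n.+1).2 x * u l x)) =
  ((\int[mu]_x (f x * u l x) - \int[mu]_x (g x * u l x)) -
    (\int[mu]_x ((matching T (f, g) n).1 x * u l x) -
     \int[mu]_x ((matching T (f, g) n).2 x * u l x))) +
  (\int[mu]_x (transported T j (matching T (f, g) n) x * u l x) -
   \int[mu]_x (transported T j (matching T (f, g) n) (T (- j) x) * u l x)).
  rewrite [matching T (f, g) n.+1]/= -/j /match_step /=.
  under [X in _ - (X - _) = _]eq_Rintegral do rewrite mulrBl.
  under [X in _ - (_ - X) = _]eq_Rintegral do rewrite mulrBl.
  rewrite RintegralB//; [|exact: mul1|exact: mul1].
  rewrite RintegralB//; [|exact: mul1|exact: (mul1 _ l pT1)].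
  ring.
under eq_fun do rewrite E.
have H := cvgD IH (transported_cvg0 j p1); rewrite addr0 in H.
exact: H.
Qed.

(** The matching is stopped after finitely many steps, when the remaining mass times [M] is at most
    [eps / 2]; only then does [l] tend to infinity. The bounds [K l] serve integrability and may
    grow with [l], whereas [M] controls the remainders uniformly. *)
Lemma equidistribution (f g : Y -> R) : l1pos mu f -> l1pos mu g ->
  \int[mu]_x f x = \int[mu]_x g x ->
  (fun l => \int[mu]_x (f x * u l x) - \int[mu]_x (g x * u l x))
    @ \oo --> (0 : R).
Proof.
move=> f1 g1 fg; apply/cvgr0Pnorm_le => eps eps0.
have [n Hn] : exists n, \int[mu]_x (matching T (f, g) n).1 x * M <= eps / 2.
  have := matching_cvg0 actT ergT f1 g1 fg.
  move=> /cvgM /(_ (cvg_cst M)); rewrite mul0r.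
  move/cvgr0Pnorm_le => /(_ (eps / 2)); rewrite divr_gt0// => /(_ isT)[n _ Hn].
  by exists n; apply: le_trans (Hn n (leqnn n)); exact: ler_norm.
have [m1 m2] := l1pos_matching actT f1 g1 n.
have mE := matching_integral actT f1 g1 fg n.
have /cvgr0Pnorm_le /(_ (eps / 2)) := matching_step_cvg n f1 g1.
rewrite divr_gt0// => /(_ isT); apply: filterS2 uM => l uMl.
set a := \int[mu]_x (f x * _); set b := \int[mu]_x (g x * _).
set a' := \int[mu]_x _; set b' := \int[mu]_x _ => ab.
have bound h : l1pos mu h -> 0 <= \int[mu]_x (h x * u l x) <= \int[mu]_x h x * M.
  move=> h1; have hu1 := l1pos_mul_bounded h1 (mu_ l) (uK l).
  rewrite Rintegral_ge0 /=; last by move=> x _; exact: hu1.1.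
  (* A negative [M] is compatible with [0 <= u l x] only if the whole space is null; in both cases
     [M] may be replaced by its maximum with 0. *)
  have M0 : 0 <= M \/ \forall x \ae mu, False.
    have [M0|M0] := leP 0 M; [by left|right].
    apply: filterS uMl => x; have /andP[u0 _] := uK l x.
    by move=> /(le_trans u0); rewrite leNgt M0.
  rewrite -RintegralZr//; last exact: h1.2.
  have -> : \int[mu]_x (h x * M) = \int[mu]_x (h x * Num.max 0 M).
    case: M0 => [M0|F]; first by rewrite max_r.
    rewrite /Rintegral; congr fine; apply: ae_eq_integral => //.
    + apply/measurable_EFinP; apply: measurable_funM => //.
      exact: l1pos_measurable h1.
    + apply/measurable_EFinP; apply: measurable_funM => //.
      exact: l1pos_measurable h1.
    + by apply: filterS F.
  apply: ae_le_Rintegral => //.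
    rewrite (_ : (fun x => _) = (fun x => Num.max 0 M * h x)).
      by apply: l1posZ; rewrite // le_max lexx.
    by apply/funext => x; rewrite mulrC.
  by apply: filterS uMl => x ux; rewrite ler_wpM2l ?h1.1// le_max ux orbT.
have /andP[a0 aM] := bound _ m1; have /andP[b0 bM] := bound _ m2.
rewrite -mE in bM.
rewrite -(subrK (a' - b') (a - b)); apply: le_trans (ler_normD _ _) _.
rewrite (splitr eps); apply: lerD => //.
rewrite ler_norml; apply/andP; split.
  by rewrite lerNl opprB (le_trans _ (le_trans bM Hn))// gerBl.
by rewrite (le_trans _ (le_trans aM Hn))// gerBl.
Qed.

End equidistribution.

(** * Actions with bounded returns *)

Definition visits (R : realType) (Y : Type) (T : int -> Y -> Y) (Z : set Y)
  (n : nat) (x : Y) : R := \sum_(0 <= m < n) \1_Z (T m%:Z x).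

(** This is all that the ergodic argument retains from the (C,F)-construction. The bound on the
    visits concerns almost every point of the whole space, not only the points of [Z]. *)
Definition bounded_returns (R : realType) d (Y : measurableType d)
    (mu : {measure set Y -> \bar R}) (T : int -> Y -> Y) (Z : set Y)
    (h : nat -> nat) (a : nat -> R) (M : R) : Prop :=
  [/\ measurable Z, mu Z = 1%E, a @ \oo --> +oo,
      forall l, a l = \sum_(0 <= m < h l) fine (mu (Z `&` T m%:Z @^-1` Z))
    & \forall l \near \oo, \forall x \ae mu, visits R T Z (h l) x <= M * a l].

Lemma ergodic_opp (R : realType) d (Y : measurableType d)
    (mu : {measure set Y -> \bar R}) (T : int -> Y -> Y) :
  exact_action mu T -> ergodic_on mu setT (T 1) -> ergodic_on mu setT (T (- 1)).
Proof.
move=> [T0 TD mT pT] erg A mA _ A0; apply: erg => //.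
rewrite setTI in A0; rewrite setTI -A0.
rewrite -[RHS](pT 1); last first.
  apply: measurableU; apply: measurableD => //;
    by rewrite -[X in measurable X]setTI; exact: mT.
congr (mu _); apply/seteqP; split => x /=; rewrite /preimage /= -TD addNr T0; tauto.
Qed.

Section weak_limit.
Context (R : realType) d (Y : measurableType d)
  (mu : {measure set Y -> \bar R}).

Lemma ae_act (T : int -> Y -> Y) (g : int) (P : Y -> Prop) : exact_action mu T ->
  (\forall x \ae mu, P x) -> \forall x \ae mu, P (T g x).
Proof.
move=> [T0 TD mT pT] [N [mN N0 PN]]; exists (T g @^-1` N); split.
- by rewrite -[X in measurable X]setTI; exact: mT.
- by rewrite pT.
- by move=> x /= Px; exact: PN.
Qed.

Lemma visits_ge0 (T : int -> Y -> Y) Z n x : 0 <= visits R T Z n x.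
Proof. by apply: sumr_ge0 => i _; rewrite indicE ler0n. Qed.

Lemma visits_le (T : int -> Y -> Y) Z n x : visits R T Z n x <= n%:R.
Proof.
rewrite -[n in leRHS]subn0 -sumr_const_nat.
by apply: ler_sum => i _; rewrite indicE lern1 leq_b1.
Qed.

Lemma visits_subset (T : int -> Y -> Y) Z Z' n x : Z `<=` Z' ->
  visits R T Z n x <= visits R T Z' n x.
Proof.
move=> ZZ'; apply: ler_sum => i _; rewrite !indicE ler_nat.
by case: (boolP (T i x \in Z)) => //; rewrite inE => /ZZ' h; rewrite mem_set.
Qed.

Lemma measurable_visits (T : int -> Y -> Y) Z n : exact_action mu T ->
  measurable Z -> measurable_fun setT (visits R T Z n).
Proof.
move=> [T0 TD mT pT] mZ; rewrite /visits.
apply: measurable_sum => i.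
exact: (measurableT_comp (measurable_indic _) (mT i)).
Qed.

(** The two windows of times differ only in their end points. *)
Lemma visits_shift (T : int -> Y -> Y) Z n x : exact_action mu T ->
  `|visits R T Z n (T 1 x) - visits R T Z n x| <= 1.
Proof.
move=> [T0 TD mT pT]; rewrite /visits -sumrB.
under eq_bigr do rewrite -TD -PoszD addn1.
rewrite telescope_sumr// !indicE ler_norml.
by case: (_ \in _); case: (_ \in _); rewrite /=; lra.
Qed.

Lemma bounded_returns_opp (T : int -> Y -> Y) Z h a M : exact_action mu T ->
  bounded_returns mu T Z h a M ->
  bounded_returns mu (fun g => T (- g)) Z h a M.
Proof.
move=> actT [mZ Z1 aoo aE aM]; have [T0 TD mT pT] := actT.
split => //.
- move=> l; rewrite aE; apply: eq_bigr => m _; congr fine.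
  rewrite -(pT (- m%:Z)); last first.
    apply: measurableI => //; rewrite -[X in measurable X]setTI; exact: mT.
  by congr (mu _); apply/seteqP; split => x /=; rewrite /preimage /= -TD addrN T0; tauto.
- apply: filterS aM => l.
  (* The backward window of [x] is the forward window of [T (- (h l).-1) x], read in reverse
     order. *)
  move=> /(ae_act (- ((h l).-1)%:Z) actT); apply: filterS => x.
  apply: le_trans; rewrite le_eqVlt; apply/orP; left; apply/eqP.
  rewrite /visits big_nat_rev /= add0n; apply: eq_big_nat => m mh.
  by rewrite -TD; congr (\1_Z (T _ x)); lia.
Qed.

Lemma Rintegral_visits (T : int -> Y -> Y) A B n : exact_action mu T ->
  measurable A -> measurable B -> (mu A < +oo)%E ->
  \int[mu]_x (\1_A x * visits R T B n x) =
  \sum_(0 <= m < n) fine (mu (A `&` T m%:Z @^-1` B)).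
Proof.
move=> actT mA mB Aoo; have [T0 TD mT pT] := actT.
have mTB m : measurable (T m @^-1` B).
  by rewrite -[X in measurable X]setTI; exact: mT.
have IE m x : \1_A x * \1_B (T m x) = \1_(A `&` T m @^-1` B) x :> R.
  by rewrite indicI.
have intI m : mu.-integrable setT (EFin \o (\1_(A `&` T m @^-1` B) : Y -> R)).
  apply: (l1pos_indic _ _).2; first exact: measurableI.
  by apply: le_lt_trans Aoo; apply: le_measure; rewrite ?inE//; exact: measurableI.
elim: n => [|n IH].
  rewrite big_geq//.
  under eq_Rintegral do rewrite /visits big_geq// mulr0.
  by rewrite /Rintegral integral0.
rewrite big_nat_recr//= -IH.
under eq_Rintegral do rewrite /visits big_nat_recr//= mulrDr IE.
rewrite RintegralD//.
  by rewrite Rintegral_indic//; exact: measurableI.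
apply: (l1pos_mul_bounded _ _ (K := n%:R) _).2.
- exact: l1pos_indic.
- exact: measurable_visits.
- by move=> x; rewrite visits_ge0 visits_le.
Qed.

Section visits_equidistribution.
Context (T : int -> Y -> Y) (actT : exact_action mu T)
  (ergT : ergodic_on mu setT (T 1)).
Context (Z : set Y) (h : nat -> nat) (a : nat -> R) (M : R).
Context (bT : bounded_returns mu T Z h a M).

(** The normalized visits to [B] are bounded by [M], since [B] lies in [Z], and they change by at
    most [1 / a l] under [T 1]; this is the setting of [equidistribution]. *)
Lemma visits_equidistribution (B : set Y) f g : measurable B -> B `<=` Z ->
  l1pos mu f -> l1pos mu g -> \int[mu]_x f x = \int[mu]_x g x ->
  (fun l => (\int[mu]_x (f x * visits R T B (h l) x) -
    \int[mu]_x (g x * visits R T B (h l) x)) / a l) @ \oo --> (0 : R).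
Proof.
move=> mB BZ f1 g1 fg; have [mZ Z1 aoo aE aM] := bT.
have a0 l : 0 <= a l by rewrite aE; apply: sumr_ge0 => i _; exact: fine_ge0.
pose u l x := visits R T B (h l) x / a l.
have mu_ l : measurable_fun setT (u l).
  by apply: measurable_funM => //; exact: measurable_visits.
have uK l x : 0 <= u l x <= (h l)%:R / a l.
  by rewrite divr_ge0 ?visits_ge0//= ler_wpM2r ?invr_ge0// visits_le.
have uM : \forall l \near \oo, \forall x \ae mu, u l x <= M.
  move/cvgryPgt : (aoo) => /(_ 0); apply: filterS2 aM => l aMl al.
  apply: filterS aMl => x; rewrite /u ler_pdivrMr//; apply: le_trans.
  exact: visits_subset.
have ue l x : `|u l (T 1 x) - u l x| <= (a l)^-1.
  rewrite /u -mulrBl normrM normfV (ger0_norm (a0 l)).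
  by rewrite ler_piMl ?invr_ge0//; exact: visits_shift.
have e0 : (fun l => (a l)^-1) @ \oo --> (0 : R).
  by apply/gtr0_cvgV0; [|exact: aoo]; move/cvgryPgt : aoo => /(_ 0).
have := equidistribution actT ergT mu_ uK uM ue e0 f1 g1 fg.
have E f' l : l1pos mu f' -> \int[mu]_x (f' x * u l x) =
    \int[mu]_x (f' x * visits R T B (h l) x) / a l.
  move=> f'1; rewrite -RintegralZr//.
    by apply: eq_Rintegral => x _; rewrite mulrA.
  apply: (l1pos_mul_bounded _ _ (K := (h l)%:R) _).2 => //.
    exact: measurable_visits.
  by move=> x; rewrite visits_ge0 visits_le.
by under eq_fun do rewrite !E// -mulrBl.
Qed.

End visits_equidistribution.

(** First [f] is replaced by its integral times the indicator of [Z]. By invariance, integrating the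
    visits to [B] over [Z] is the same as integrating the backward visits to [Z] over [B].
    Equidistribution of the inverse action then replaces the indicator of [B] by [mu B] times that
    of [Z], and what remains is [a l]. *)
Lemma visits_weak_limit (T : int -> Y -> Y) Z h a M B f :
  exact_action mu T -> ergodic_on mu setT (T 1) ->
  bounded_returns mu T Z h a M -> measurable B -> B `<=` Z -> l1pos mu f ->
  (fun l => \int[mu]_x (f x * visits R T B (h l) x) / a l) @ \oo -->
    fine (mu B) * \int[mu]_x f x.
Proof.
move=> actT ergT bT mB BZ f1; have [mZ Z1 aoo aE aM] := bT.
have actT' := exact_action_opp actT; have bT' := bounded_returns_opp actT bT.
have ergT' := ergodic_opp actT ergT.
have [T0 TD mT pT] := actT.
have Zoo : (mu Z < +oo)%E by rewrite Z1 ltry.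
have Boo : (mu B < +oo)%E.
  by apply: le_lt_trans Zoo; apply: le_measure; rewrite ?inE.
have Z11 := l1pos_indic mZ Zoo; have B11 := l1pos_indic mB Boo.
have iZ : \int[mu]_x (\1_Z x : R) = 1 by rewrite Rintegral_indic// Z1.
have If0 : 0 <= \int[mu]_x f x by apply: Rintegral_ge0 => x _; exact: f1.1.
have H1 := visits_equidistribution actT ergT bT mB BZ f1 (l1posZ If0 Z11).
rewrite RintegralZl ?iZ ?mulr1 in H1; [|by []|exact: Z11.2].
have {}H1 := H1 erefl.
have H2 := visits_equidistribution actT' ergT' bT' mZ (@subset_refl _ Z) B11
  (l1posZ (fine_ge0 (measure_ge0 mu B)) Z11).
rewrite RintegralZl ?iZ ?mulr1 ?Rintegral_indic// in H2; last exact: Z11.2.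
have {}H2 := H2 erefl.
have sw l : \int[mu]_x (\1_B x * visits R (fun g => T (- g)) Z (h l) x) =
    \int[mu]_x (\1_Z x * visits R T B (h l) x).
  rewrite !Rintegral_visits//; apply: eq_bigr => m _; congr fine.
  rewrite -(pT m); last first.
    by apply: measurableI => //; rewrite -[X in measurable X]setTI; exact: mT.
  by congr (mu _); apply/seteqP; split => x /=; rewrite /preimage /= -TD addNr T0; tauto.
have swZ l : \int[mu]_x (\1_Z x * visits R (fun g => T (- g)) Z (h l) x) = a l.
  by have [_ _ _ aE' _] := bT'; rewrite Rintegral_visits// aE'.
have cE c n (T' : int -> Y -> Y) B' : exact_action mu T' -> measurable B' ->
    \int[mu]_x (c * \1_Z x * visits R T' B' n x) =
    c * \int[mu]_x (\1_Z x * visits R T' B' n x).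
  move=> aT' mB'; rewrite -RintegralZl//.
    by apply: eq_Rintegral => x _; rewrite mulrA.
  apply: (l1pos_mul_bounded _ _ (K := n%:R) _).2 => //.
    exact: measurable_visits.
  by move=> x; rewrite visits_ge0 visits_le.
(* For small [l] the number [a l] may be 0, so this quotient is only eventually equal to 1. *)
have c1 : (fun l => a l / a l) @ \oo --> (1 : R).
  apply: (@cvg_near_cst _ _ (1 : R)); move/cvgryPgt : aoo => /(_ 0).
  by apply: filterS => l al; rewrite divff// gt_eqF.
have H3 : (fun l => \int[mu]_x f x * ((\int[mu]_x (\1_B x *
      visits R (fun g : int => T (- g)) Z (h l) x) -
     \int[mu]_x (fine (mu B) * \1_Z x *
      visits R (fun g : int => T (- g)) Z (h l) x)) / a l)) @ \oo --> (0 : R).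
  by rewrite -(mulr0 (\int[mu]_x f x)); apply: cvgM; [exact: cvg_cst|exact: H2].
have H4 : (fun l => \int[mu]_x f x * fine (mu B) * (a l / a l)) @ \oo -->
    fine (mu B) * \int[mu]_x f x.
  rewrite mulrC -[X in _ --> X]mulr1; apply: cvgM; [exact: cvg_cst|exact: c1].
have H := cvgD (cvgD H1 H3) H4; rewrite addr0 add0r in H.
(* The summands are the error from replacing [f], the error from replacing the indicator of [B], and
   the main term. *)
have E l : \int[mu]_x (f x * visits R T B (h l) x) / a l =
    (\int[mu]_x (f x * visits R T B (h l) x) -
     \int[mu]_x (\int[mu]_x0 f x0 * \1_Z x * visits R T B (h l) x)) / a l +
    \int[mu]_x f x * ((\int[mu]_x (\1_B x *
      visits R (fun g : int => T (- g)) Z (h l) x) -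
     \int[mu]_x (fine (mu B) * \1_Z x *
      visits R (fun g : int => T (- g)) Z (h l) x)) / a l) +
    \int[mu]_x f x * fine (mu B) * (a l / a l).
  by rewrite !cE// sw swZ; ring.
under eq_fun do rewrite E.
exact: H.
Qed.

End weak_limit.

(** * Auxiliary measure theory: null sets, densities and factor maps *)

Definition as_sigma_finite (R : realType) d (Y : measurableType d)
  (mu : {measure set Y -> \bar R}) (_ : sigma_finite setT mu) : set Y -> \bar R :=
  mu.

HB.instance Definition _ (R : realType) d (Y : measurableType d)
  (mu : {measure set Y -> \bar R}) (sf : sigma_finite setT mu) :=
  Measure.on (as_sigma_finite sf).

HB.instance Definition _ (R : realType) d (Y : measurableType d)
  (mu : {measure set Y -> \bar R}) (sf : sigma_finite setT mu) :=
  Measure_isSigmaFinite.Build _ _ _ (as_sigma_finite sf) sf.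

(** Like [as_sigma_finite], a copy of the measure indexed by a proof, to which the matching
    structure is attached; [density] applies the Radon-Nikodym theorem to these copies. *)
Definition as_finite (R : realType) d (Y : measurableType d)
  (mu : {measure set Y -> \bar R}) (_ : fin_num_fun mu) : set Y -> \bar R := mu.

HB.instance Definition _ (R : realType) d (Y : measurableType d)
  (mu : {measure set Y -> \bar R}) (fin : fin_num_fun mu) :=
  Measure.on (as_finite fin).

HB.instance Definition _ (R : realType) d (Y : measurableType d)
  (mu : {measure set Y -> \bar R}) (fin : fin_num_fun mu) :=
  Measure_isFinite.Build _ _ _ (as_finite fin) fin.

Section almost_everywhere.
Context (R : realType) d (Y : measurableType d) (mu : {measure set Y -> \bar R}).

Lemma ae_forall_countable (I : countType) (P : I -> Y -> Prop) :
  (forall i, \forall x \ae mu, P i x) -> \forall x \ae mu, forall i, P i x.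
Proof.
move=> H; have : \forall x \ae mu, forall n,
    if choice.unpickle n is Some i then P i x else True.
  apply: ae_foralln => n; case: choice.unpickle => [i|]; first exact: H.
  exact: aeW.
by apply: filterS => x Hx i; have := Hx (choice.pickle i); rewrite choice.pickleK.
Qed.

Lemma measure_ae_eq (A B : set Y) : measurable A -> measurable B ->
  (\forall x \ae mu, A x <-> B x) -> mu A = mu B.
Proof.
move=> mA mB [N [mN N0 AB]].
have le C D : measurable C -> measurable D -> (forall x, ~ N x -> C x -> D x) ->
    (mu C <= mu D)%E.
  move=> mC mD CD; rewrite -(measureU0 mD mN N0).
  apply: le_measure; rewrite ?inE//; first exact: measurableU.
  by move=> x Cx; have [Nx|Nx] := pselect (N x); [right|left; exact: CD].
have nN x : ~ N x -> (A x <-> B x) by move=> Nx; apply: contrapT => /AB.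
by apply: le_anti; rewrite !le// => x /nN[].
Qed.

(** The Radon-Nikodym derivative is finite at every point, so [fine] turns it into a real function
    to which [visits_weak_limit] applies. *)
Lemma density (rho : {measure set Y -> \bar R}) : sigma_finite setT mu ->
  (rho setT < +oo)%E ->
  (forall A, measurable A -> mu A = 0%E -> rho A = 0%E) ->
  exists2 w, l1pos mu w &
    forall A, measurable A -> fine (rho A) = \int[mu]_x (w x * \1_A x).
Proof.
move=> sf foo dom.
have fin : fin_num_fun rho.
  move=> A mA; rewrite ge0_fin_numE//; apply: le_lt_trans foo.
  by apply: le_measure; rewrite ?inE.
have dom' : as_finite fin `<< as_sigma_finite sf.
  move=> N N0 A mA AN; exact: (dom _ mA (N0 _ mA AN)).
have [f [f0 ffin fi fE]] := radon_nikodym_sigma_finite dom'.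
have wE : EFin \o (fine \o f) = f by apply/funext => x /=; rewrite fineK.
exists (fine \o f).
  by split; [move=> x; exact: fine_ge0|rewrite wE].
move=> A mA; have rhoE : rho A = (\int[mu]_(x in A) f x)%E by exact: fE.
rewrite rhoE /Rintegral; congr fine.
rewrite integral_mkcond; apply: eq_integral => x _.
rewrite patchE indicE; case: ifP => _; last by rewrite mulr0.
by rewrite mulr1; rewrite -[in LHS]wE.
Qed.

End almost_everywhere.

(** It transfers bounded returns from the (C,F)-model to an isomorphic action, and, with the
    identity as [phi], from an action to another one that agrees with it almost everywhere. *)
Lemma bounded_returns_factor (R : realType) d (Y : measurableType d)
    (nu : {measure set Y -> \bar R}) (T : int -> Y -> Y)
    d' (Y' : measurableType d') (mu : {measure set Y' -> \bar R})
    (T' : int -> Y' -> Y') (phi : Y -> Y') Z h a M :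
  measurable_fun setT phi ->
  (forall A, measurable A -> nu (phi @^-1` A) = mu A) ->
  (forall g, \forall y \ae nu, phi (T g y) = T' g (phi y)) ->
  (forall g, measurable_fun setT (T g)) ->
  (forall g, measurable_fun setT (T' g)) ->
  bounded_returns mu T' Z h a M -> bounded_returns nu T (phi @^-1` Z) h a M.
Proof.
move=> mphi pphi comm mT mT' [mZ Z1 aoo aE aM].
have pre dd dd' (W : measurableType dd) (W' : measurableType dd') (f : W -> W') A :
    measurable_fun setT f -> measurable A -> measurable (f @^-1` A).
  by move=> mf mA; rewrite -[X in measurable X]setTI; exact: mf.
have pae (P : Y' -> Prop) : (\forall x \ae mu, P x) -> \forall y \ae nu, P (phi y).
  move=> [N [mN N0 PN]]; exists (phi @^-1` N); split; first exact: pre.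
    by rewrite pphi.
  by move=> x; exact: (PN (phi x)).
split => //; first exact: pre.
- by rewrite pphi.
- move=> l; rewrite aE; apply: eq_bigr => m _; congr fine.
  rewrite -pphi; last by apply: measurableI => //; exact: pre.
  apply: measure_ae_eq.
  + by apply: (pre) => //; apply: measurableI => //; exact: pre.
  + by apply: measurableI; [exact: pre|apply: (pre) => //; exact: pre].
  + by apply: filterS (comm m) => y cy; rewrite /preimage /= cy.
- apply: filterS aM => l /pae; have := ae_forall_countable comm.
  apply: filterS2 => y cy; apply: le_trans.
  rewrite le_eqVlt; apply/orP; left; apply/eqP; apply: eq_bigr => m _.
  by rewrite !indicE -cy.
Qed.

(** * Replacing an action mod 0 by an exact one *)

Section exactification.
Context (R : realType) d (Y : measurableType d) (mu : {measure set Y -> \bar R}).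

(** Countably many identities fail only on a null set [N]. Outside of [N1], the union of [N] and its
    preimages under all [T g], the identities hold and orbits never enter [N1]; on [N1] the new
    action is the identity. *)
Lemma exact_version (T : int -> Y -> Y) : measure_preserving_action mu T ->
  exists2 T', exact_action mu T' & forall g, \forall x \ae mu, T' g x = T g x.
Proof.
move=> [mT pT T0 TD].
have pre g A : measurable A -> measurable (T g @^-1` A).
  by move=> mA; rewrite -[X in measurable X]setTI; exact: mT.
have [N [mN N0 GN]] : \forall x \ae mu, T 0 x = x /\
    forall gh : int * int, T (gh.1 + gh.2) x = T gh.1 (T gh.2 x).
  by apply: filterS2 T0 (ae_forall_countable (fun gh => TD gh.1 gh.2)) => x ? ?.
pose N1 := N `|` \bigcup_n (T (odflt (0 : int) (choice.unpickle n)) @^-1` N).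
have mN1 : measurable N1.
  by apply: measurableU => //; apply: bigcup_measurable => n _; exact: pre.
have N10 : mu N1 = 0%E.
  apply/negligibleP => //; apply: negligibleU; first by exists N; split.
  apply: negligible_bigcup => n; exists (T (odflt (0 : int) (choice.unpickle n)) @^-1` N).
  by split => //; [exact: pre|rewrite pT].
have G1 x : ~ N1 x -> [/\ T 0 x = x, forall g h, T (g + h) x = T g (T h x) &
    forall g, ~ N (T g x)].
  move=> nx; have nNx : ~ N x by move=> ?; apply: nx; left.
  have [T0x TDx] : T 0 x = x /\
    forall gh : int * int, T (gh.1 + gh.2) x = T gh.1 (T gh.2 x).
    by apply: contrapT => /GN.
  split => // [g h|g Ng]; first exact: (TDx (g, h)).
  by apply: nx; right; exists (choice.pickle g) => //; rewrite choice.pickleK.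
have N1T g x : ~ N1 x -> ~ N1 (T g x).
  move=> /G1[T0x TDx nNx] [/nNx//|[n _ /=]].
  by rewrite -TDx => /nNx.
pose T' g x := if x \in N1 then x else T g x.
have T'T g : \forall x \ae mu, T' g x = T g x.
  exists N1; split => // x /= Hx; apply: contrapT => nx; apply: Hx.
  by rewrite /T' memNset.
have mT' g : measurable_fun setT (T' g).
  move=> _ A mA; rewrite setTI.
  have -> : T' g @^-1` A = (N1 `&` A) `|` (~` N1 `&` T g @^-1` A).
    apply/seteqP; split => x; rewrite /preimage /T' /=.
      by case: ifPn; [rewrite inE; left|rewrite notin_setE; right].
    by move=> [[nx Ax]|[nx Ax]]; [rewrite mem_set|rewrite memNset].
  apply: measurableU; apply: measurableI => //; first exact: measurableC.
  exact: pre.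
exists T' => //; split => //.
- move=> x; rewrite /T'; case: ifPn => //; rewrite notin_setE => nx.
  by have [] := G1 _ nx.
- move=> g h x; rewrite /T'; case: ifPn => [xN|]; first by rewrite xN.
  rewrite notin_setE => nx; rewrite memNset; last exact: N1T.
  by have [_ -> _] := G1 _ nx.
- move=> g A mA; rewrite -(pT g A mA); apply: measure_ae_eq => //.
  + by rewrite -[X in measurable X]setTI; exact: mT'.
  + exact: pre.
  + by apply: filterS (T'T g) => x E; rewrite /preimage /= E.
Qed.

Lemma ergodic_ae (T T' : int -> Y -> Y) :
  (forall g, measurable_fun setT (T g)) ->
  (forall g, measurable_fun setT (T' g)) ->
  (forall g, \forall x \ae mu, T' g x = T g x) ->
  ergodic_on mu setT (T 1) -> ergodic_on mu setT (T' 1).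
Proof.
move=> mT mT' T'T erg A mA _; rewrite setTI => A0; apply: erg => //.
have pre (f : Y -> Y) B : measurable_fun setT f -> measurable B -> measurable (f @^-1` B).
  by move=> mf mB; rewrite -[X in measurable X]setTI; exact: mf.
rewrite setTI -A0; apply: measure_ae_eq.
- by apply: measurableU; apply: measurableD => //; exact: pre.
- by apply: measurableU; apply: measurableD => //; exact: pre.
- by apply: filterS (T'T 1) => x E; rewrite /preimage /= E.
Qed.

End exactification.

(** * The limit of the normalized return sums *)

Section returns_limit.
Context (R : realType) d (Y : measurableType d) (mu : {measure set Y -> \bar R})
  (T : int -> Y -> Y) (Z : set Y) (h : nat -> nat) (a : nat -> R) (M : R).
Context (actT : measure_preserving_action mu T)
  (ergT : ergodic_on mu setT (T 1)) (bT : bounded_returns mu T Z h a M).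

(** Preimages under [T (- m)] play the role of images under [T m], so the weak limit is applied to
    the inverse of an exact version, with the indicator of [A] as density. *)
Lemma returns_limit A B : measurable A -> measurable B -> A `<=` Z -> B `<=` Z ->
  (fun l => (\sum_(0 <= m < h l) fine (mu (A `&` T (- m%:Z) @^-1` B))) / a l)
    @ \oo --> fine (mu A) * fine (mu B).
Proof.
move=> mA mB AZ BZ; have [T' aT' T'T] := exact_version actT.
have [mT pT _ _] := actT; have [T'0 T'D mT' pT'] := aT'.
have ergT' := ergodic_ae mT mT' T'T ergT.
have bT' : bounded_returns mu T' Z h a M.
  by apply: (@bounded_returns_factor _ _ _ _ _ _ _ mu T id _ _ _ _ _ _ _ _ _ bT).
have [_ Z1 _ _ _] := bT.
have Aoo : (mu A < +oo)%E.
  rewrite (@le_lt_trans _ _ (mu Z)) ?Z1 ?ltry// -Z1.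
  by have [mZ _ _ _ _] := bT; apply: le_measure; rewrite ?inE.
have H := visits_weak_limit (exact_action_opp aT') (ergodic_opp aT' ergT')
  (bounded_returns_opp aT' bT') mB BZ (l1pos_indic mA Aoo).
rewrite Rintegral_indic// mulrC in H.
have E l : \sum_(0 <= m < h l) fine (mu (A `&` T (- m%:Z) @^-1` B)) =
    \int[mu]_x (\1_A x * visits R (fun g => T' (- g)) B (h l) x).
  rewrite (Rintegral_visits _ (exact_action_opp aT') mA mB Aoo).
  apply: eq_bigr => m _; congr fine; apply: measure_ae_eq.
  - by apply: measurableI => //; rewrite -[X in measurable X]setTI; exact: mT.
  - by apply: measurableI => //; rewrite -[X in measurable X]setTI; exact: mT'.
  - by apply: filterS (T'T (- m%:Z)) => x E; rewrite /preimage /= E.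
under eq_fun do rewrite E.
exact: H.
Qed.

End returns_limit.

(** * Nonsingular maps that commute with the action *)

Section nonsingular_commuting.
Context (R : realType) d (Y : measurableType d) (mu : {measure set Y -> \bar R})
  (T : int -> Y -> Y) (Z : set Y) (h : nat -> nat) (a : nat -> R) (M : R).
Context (actT : exact_action mu T) (ergT : ergodic_on mu setT (T 1))
  (bT : bounded_returns mu T Z h a M).
Context (S : Y -> Y) (nS : nonsingular mu S)
  (ST : forall g, \forall x \ae mu, S (T g x) = T g (S x)).

Let mZ : measurable Z. Proof. by case: bT. Qed.
Let Z1 : mu Z = 1%E. Proof. by case: bT. Qed.
Let Zoo : (mu Z < +oo)%E. Proof. by rewrite Z1 ltry. Qed.
Let pre (f : Y -> Y) A :
  measurable_fun setT f -> measurable A -> measurable (f @^-1` A).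
Proof. by move=> mf mA; rewrite -[X in measurable X]setTI; exact: mf. Qed.
Let mTpre g A : measurable A -> measurable (T g @^-1` A).
Proof. by have [_ _ mT _] := actT; exact: pre. Qed.
Let mSpre A : measurable A -> measurable (S @^-1` A).
Proof. by apply: pre; case: nS. Qed.

Let G n := T (odflt (0 : int) (choice.unpickle n)) @^-1` Z.
Let U := \bigcup_n G n.
Let mG n : measurable (G n). Proof. exact: mTpre. Qed.
Let mU : measurable U. Proof. by apply: bigcup_measurable => n _; exact: mG. Qed.
Let G1 n : mu (G n) = 1%E.
Proof. by have [_ _ _ pT] := actT; rewrite /G pT. Qed.

Let UC0 : mu (~` U) = 0%E.
Proof. by apply: (orbit_saturation actT ergT mZ); rewrite Z1 onee_neq0. Qed.

Lemma bounded_returns_sigma_finite : sigma_finite setT mu.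
Proof.
(* The translates of [Z] have measure 1 and miss only a null set, which is added to each of them. *)
exists (fun n => G n `|` ~` U).
  apply/seteqP; split => x // _; have [[n _ Gx]|nU] := pselect (U x).
    by exists n => //; left.
  by exists 0%N => //; right.
move=> n; have mUC : measurable (~` U) by exact: measurableC.
split; first exact: measurableU.
by rewrite measureU0// G1 ltry.
Qed.

(** Up to a null set, [E] is the increasing union of its intersections with finite unions of
    translates of [Z], which have finite measure. This bounds a set that is not yet known to have
    finite measure. *)
Let finite_cover E r : measurable E ->
  (forall E', measurable E' -> E' `<=` E -> (mu E' < +oo)%E -> (mu E' <= r)%E) ->
  (mu E <= r)%E.
Proof.
move=> mE H; pose F n := E `&` \big[setU/set0]_(i < n) G i.
have mB n : measurable (\big[setU/set0]_(i < n) G i).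
  exact: bigsetU_measurable.
have mF n : measurable (F n) by exact: measurableI.
have Foo n : (mu (F n) < +oo)%E.
  apply: (@le_lt_trans _ _ (mu (\big[setU/set0]_(i < n) G i))).
    by apply: le_measure; rewrite ?inE//; exact: subIsetr.
  apply: (@le_lt_trans _ _ (\sum_(i < n) mu (G i))%E).
    exact: Boole_inequality.
  by rewrite (eq_bigr (fun=> 1%:E)) ?sumEFin ?ltry// => i _; exact: G1.
have FE : \bigcup_n F n = E `&` U.
  rewrite /F -setI_bigcupr; congr (_ `&` _).
  apply/seteqP; split => x.
    by move=> [n _]; rewrite -bigcup_mkord => -[i _ Gx]; exists i.
  by move=> [n _ Gx]; exists n.+1 => //; rewrite big_ord_recr /=; right.
have -> : mu E = mu (\bigcup_n F n).
  rewrite FE -(measureU0 (measurableI _ _ mE mU) (measurableC mU) UC0).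
  apply: measure_ae_eq => //.
    by apply: measurableU; [exact: measurableI|exact: measurableC].
  exists (~` U); split => //; first exact: measurableC.
  by move=> x /= nx Ux; apply: nx; split; [left|case=> [[]|]].
have ndF : nondecreasing_seq F.
  move=> m n mn; rewrite subsetEset; apply: setIS.
  by apply: subset_bigsetU.
have Fcv := @nondecreasing_cvg_mu _ _ _ mu F mF
  (bigcup_measurable (fun n _ => mF n)) ndF.
rewrite -(cvg_lim _ Fcv)//.
apply: lime_le; first by apply/cvg_ex; eexists; exact: Fcv.
by apply: nearW => n; apply: H => //; exact: subIsetl.
Qed.

(** The backward limit is available only for sets of finite measure, so it is first applied to the
    subsets of [E] of finite measure. This gives [mu E <= mu A]; then [E] itself is admissible and
    the two limits coincide. *)
Lemma preimage_measure_sub A : measurable A -> A `<=` Z -> mu (S @^-1` A) = mu A.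
Proof.
move=> mA AZ; set E := S @^-1` A; have [T0 TD mT pT] := actT.
have mE : measurable E by exact: mSpre.
have [_ _ aoo aE _] := bT.
have a0 l : 0 <= a l by rewrite aE; apply: sumr_ge0 => i _; exact: fine_ge0.
have Aoo : (mu A < +oo)%E.
  by apply: le_lt_trans Zoo; apply: le_measure; rewrite ?inE.
have mS : measurable_fun setT S by case: nS.
pose rho := pushforward (mrestr mu mZ) S.
pose rhom : {measure set Y -> \bar R} :=
  measure_function_pushforward__canonical__measure_function_Measure (mrestr mu mZ) mS.
have rhoE B : rhom B = mu (S @^-1` B `&` Z) by [].
have [|B mB B0|w w1 wE] := @density _ _ _ mu rhom bounded_returns_sigma_finite.
- by rewrite rhoE preimage_setT setTI.
- rewrite rhoE; apply/eqP; rewrite -measure_le0.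
  have [_ /(_ B mB)[_ /(_ B0) <-]] := nS.
  by apply: le_measure; rewrite ?inE; [apply: measurableI => //; exact: mSpre|
    exact: mSpre|exact: subIsetl].
have w_int : \int[mu]_x w x = 1.
  have := wE _ measurableT; rewrite rhoE preimage_setT setTI Z1 /= => E1.
  by rewrite [RHS]E1; apply: eq_Rintegral => x _; rewrite indicT mulr1.
have L n : \int[mu]_x (w x * visits R T A n x) =
    \sum_(0 <= m < n) fine (mu (E `&` T (- m%:Z) @^-1` Z)).
  elim: n => [|n IH].
    rewrite big_geq//.
    under eq_Rintegral do rewrite /visits big_geq// mulr0.
    by rewrite /Rintegral integral0.
  rewrite big_nat_recr//= -IH.
  under eq_Rintegral do rewrite /visits big_nat_recr//= mulrDr.
  have i1 : mu.-integrable setT (EFin \o (fun x => w x * visits R T A n x)).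
    apply: (l1pos_mul_bounded _ _ (K := n%:R) _).2 => //.
      exact: (measurable_visits n actT mA).
    by move=> x; rewrite visits_ge0 visits_le.
  have i2 : mu.-integrable setT (EFin \o (fun x => w x * \1_A (T n%:Z x))).
    apply: (l1pos_mul_bounded (u := \1_A \o T n) _ _ (K := 1) _).2 => //.
      exact: (measurableT_comp (measurable_indic _) (mT n)).
    by move=> x /=; rewrite indicE; case: (_ \in _); rewrite /= ?lexx ?ler01.
  rewrite RintegralD//; congr (_ + _).
  have /esym := wE _ (mTpre n mA).
  under eq_Rintegral do rewrite /preimage indicE /=.
  move=> ->; congr fine; rewrite rhoE.
  transitivity (mu (T n%:Z @^-1` (E `&` T (- n%:Z) @^-1` Z))); last first.
    by rewrite pT//; apply: measurableI => //; exact: mTpre.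
  apply: measure_ae_eq.
  - by apply: measurableI => //; apply: mSpre; exact: mTpre.
  - by apply: mTpre; apply: measurableI => //; exact: mTpre.
  - apply: filterS (ST n) => x sx.
    by rewrite /preimage /E /preimage /= sx -TD addNr T0.
have Lcv := visits_weak_limit actT ergT bT mA AZ w1.
rewrite w_int mulr1 in Lcv.
have Kcv E' : measurable E' -> (mu E' < +oo)%E ->
    (fun l => (\sum_(0 <= m < h l) fine (mu (E' `&` T (- m%:Z) @^-1` Z))) / a l)
      @ \oo --> fine (mu E').
  move=> mE' E'oo.
  have := visits_weak_limit (exact_action_opp actT) (ergodic_opp actT ergT)
    (bounded_returns_opp actT bT) mZ (@subset_refl _ Z) (l1pos_indic mE' E'oo).
  rewrite Rintegral_indic// Z1 mul1r.
  by under eq_fun do rewrite (Rintegral_visits _ (exact_action_opp actT) mE' mZ E'oo).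
have E_le : (mu E <= mu A)%E.
  apply: finite_cover => // E' mE' E'E E'oo.
  rewrite -(fineK (x := mu E')) ?ge0_fin_numE// -(fineK (x := mu A)) ?ge0_fin_numE//.
  rewrite lee_fin; apply: ler_cvg_to (Kcv _ mE' E'oo) Lcv _.
  apply: nearW => l; rewrite L ler_wpM2r ?invr_ge0//; apply: ler_sum => m _.
  have mTZ : measurable (T (- m%:Z) @^-1` Z) by exact: mTpre.
  have sub B : measurable B -> (mu (B `&` T (- m%:Z) @^-1` Z) < +oo)%E.
    move=> mB; apply: (@le_lt_trans _ _ (mu (T (- m%:Z) @^-1` Z))).
      by apply: le_measure; rewrite ?inE//; exact: measurableI.
    by rewrite pT.
  apply: fine_le; rewrite ?ge0_fin_numE ?sub//.
  by apply: le_measure; rewrite ?inE; [exact: measurableI|exact: measurableI|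
    exact: setSI].
have Eoo : (mu E < +oo)%E by exact: le_lt_trans Aoo.
have := Kcv E mE Eoo; under eq_fun do rewrite -L.
move=> Ecv.
have EA : fine (mu A) = fine (mu E) by apply: (cvg_unique _ Lcv Ecv).
by rewrite -(fineK (x := mu E)) ?ge0_fin_numE// -EA fineK ?ge0_fin_numE.
Qed.

(** The set is cut into disjoint pieces, each contained in one translate of [Z]. A piece is moved
    into [Z], where [preimage_measure_sub] applies, and moved back by means of the commutation. *)
Lemma preimage_measure A : measurable A -> mu (S @^-1` A) = mu A.
Proof.
move=> mA; have [T0 TD mT pT] := actT.
pose D n := A `&` seqDU G n.
have mD n : measurable (D n).
  by apply: measurableI => //; exact: seqDU_measurable.
have tD : trivIset setT D.
  by apply: trivIset_setIl; exact: trivIset_seqDU.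
have UD : \bigcup_n D n = A `&` U by rewrite /D -setI_bigcupr -seqDU_bigcup_eq.
have SD n : mu (S @^-1` D n) = mu (D n).
  set j := odflt (0 : int) (choice.unpickle n).
  have := @preimage_measure_sub (T (- j) @^-1` D n).
  rewrite pT// => <-; last 2 first.
  - exact: mTpre.
  - move=> x [_]; rewrite /seqDU /G -/j => -[] /=.
    by rewrite -TD addrN T0.
  rewrite -(pT (- j)); last exact: mSpre.
  apply: measure_ae_eq.
  - by apply: mTpre; exact: mSpre.
  - by apply: mSpre; exact: mTpre.
  - by apply: filterS (ST (- j)) => x sx; rewrite /preimage /= sx.
have AE : mu A = mu (\bigcup_n D n).
  rewrite UD; apply: measure_ae_eq => //; first exact: measurableI.
  exists (~` U); split => //; first exact: measurableC.
  by move=> x /= nx Ux; apply: nx; split => [|[]].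
have SAE : mu (S @^-1` A) = mu (\bigcup_n S @^-1` D n).
  apply: measure_ae_eq; first exact: mSpre.
    by apply: bigcup_measurable => n _; exact: mSpre.
  (* The points that [S] sends outside of all translates of [Z] form a null set because [S] is
     nonsingular. *)
  exists (S @^-1` (~` U)); split => //.
  - by apply: mSpre; exact: measurableC.
  - by have [_ ->] := nS; [exact: UC0|exact: measurableC].
  - move=> x /= nx Ux; apply: nx; rewrite -preimage_bigcup UD.
    by split => [|[]].
rewrite SAE AE !measure_bigcup//.
- by apply: eq_eseriesr => n _; exact: SD.
- by move=> n _; exact: mSpre.
- move=> i j _ _ [x [/= Dix Djx]]; apply: tD => //.
  by exists (S x).
Qed.

End nonsingular_commuting.

Lemma bounded_returns_non_squashable (R : realType) d (Y : measurableType d)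
    (mu : {measure set Y -> \bar R}) (T : int -> Y -> Y) Z h a M :
  measure_preserving_action mu T -> ergodic_on mu setT (T 1) ->
  bounded_returns mu T Z h a M -> non_squashable mu T.
Proof.
move=> actT ergT bT S nS ST A mA; have [T' aT' T'T] := exact_version actT.
have [mT pT _ _] := actT; have [T'0 T'D mT' pT'] := aT'.
have ergT' := ergodic_ae mT mT' T'T ergT.
have bT' : bounded_returns mu T' Z h a M.
  by apply: (@bounded_returns_factor _ _ _ _ _ _ _ mu T id _ _ _ _ _ _ _ _ _ bT).
apply: (preimage_measure aT' ergT' bT' nS) => // g.
(* The two actions agree at [S x] for almost every [x], since preimages of null sets under [S] are
   null. *)
have TS : \forall x \ae mu, T' g (S x) = T g (S x).
  have [N [mN N0 NP]] := T'T g; have [mS nS0] := nS.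
  exists (S @^-1` N); split.
  - by rewrite -[X in measurable X]setTI; exact: mS.
  - by apply/nS0.
  - by move=> x; exact: (NP (S x)).
by apply: filterS3 (T'T g) (ST g) TS => x -> -> ->.
Qed.

(** * Points of a (C,F)-space *)

Section level_points.
Context (k : nat) (D : CF_data k).
Implicit Types (s t : seq_ambient k) (x y : CFspace D) (g : int).

Definition shift g s : seq_ambient k := (translate g s.1, s.2).

(** The sequence [s] gives the coordinates of [x] at level [n]. Arguments about the quotient thus
    become arguments about sequences. *)
Definition represents n s x := exists2 p : Xn D n, set_val p = s & x = inX p.

Lemma prodn_add (f : G' k) c m j :
  prodn f c (m + j) = obind (fun z => prodn z (fun i => c (m + i)%N) j) (prodn f c m).
Proof.
elim: j => [|j IH]; first by rewrite addn0; case: prodn.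
by rewrite addnS /= IH; case: (prodn f c m).
Qed.

Lemma eq_prodn (f : G' k) c c' m : (forall i, (i < m)%N -> c i = c' i) ->
  prodn f c m = prodn f c' m.
Proof.
elim: m => //= m IH cc'; rewrite IH; last by move=> i im; apply: cc'; exact: ltnW.
by rewrite cc'.
Qed.

Lemma pmul_translate g (f : G' k) c :
  pmul (translate g f) c = omap (translate g) (pmul f c).
Proof. by rewrite /pmul /translate /=; case: ifP => //= _; rewrite addrA. Qed.

Lemma prodn_translate g (f : G' k) c m :
  prodn (translate g f) c m = omap (translate g) (prodn f c m).
Proof.
by elim: m => //= m ->; case: prodn => //= z; exact: pmul_translate.
Qed.

Lemma Xn_iter n m s : Xn D n s -> Xn D (m + n) (iter m (@embed k) s).
Proof. by elim: m => //= m IH /IH; exact: Xn_embed. Qed.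

Lemma iter_embed_snd m s i : (iter m (@embed k) s).2 i = s.2 (m + i)%N.
Proof. by elim: m i => //= m IH i; rewrite IH addnS. Qed.

Lemma iter_embed_fst n m s : Xn D n s ->
  prodn s.1 s.2 m = Some (iter m (@embed k) s).1.
Proof.
move=> Xs; elim: m => //= m IH; rewrite IH /= iter_embed_snd addn0.
have [_ _ /(_ m.+1)] := Xs; rewrite /= IH /=.
by case: pmul.
Qed.

(** The copies of [CF_F D n] inside the next level are disjoint, so the product determines [c 0];
    cancellation then recovers [f]. *)
Lemma embed_inj n s t : Xn D n s -> Xn D n t -> embed s = embed t -> s = t.
Proof.
move=> Xs Xt st.
have E1 u : Xn D n u -> pmul u.1 (u.2 0%N) = Some (embed u).1.
  exact: (iter_embed_fst 1).
have cc' i : s.2 i.+1 = t.2 i.+1 by exact: (congr1 (fun u => u.2 i) st).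
have := E1 s Xs; have := E1 t Xt; rewrite -st => {E1 st}.
move: (embed s).1 => z E' E.
have [sF sC _] := Xs; have [tF tC _] := Xt.
case: s sF sC cc' E {Xs} => f c; case: t tF tC E' {Xt} => f' c' /=.
move=> f'F c'C E' fF cC cc' E.
have c0 : c 0%N = c' 0%N.
  apply: contrapT => /eqP ne.
  have := cC 0%N; have := c'C 0%N; rewrite addn0 => c'0 c0.
  have := CF_disj c0 c'0 ne.
  move/seteqP => [/(_ z)+ _]; apply; split.
    by exists f, (c 0%N).
  by exists f', (c' 0%N).
congr pair; last by apply/funext => -[|i].
move: E E'; rewrite -c0 /pmul; case: ifP => // /eqP f1 [<-].
case: ifP => // /eqP f'1 [/addIr].
by case: f f' f1 f'1 {fF f'F} => [? ?] [? ?] /= -> -> ->.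
Qed.

Lemma iter_embed_inj n m s t : Xn D n s -> Xn D n t ->
  iter m (@embed k) s = iter m (@embed k) t -> s = t.
Proof.
move=> Xs Xt; elim: m => //= m IH E; apply: IH.
exact: (embed_inj (Xn_iter m Xs) (Xn_iter m Xt) E).
Qed.

Lemma represents_Xn n s x : represents n s x -> Xn D n s.
Proof. by move=> [p <- _]; exact: set_valP. Qed.

Lemma represents_inX n s (Xs : Xn D n s) :
  represents n s (inX (exist (fun z => z \in Xn D n) s (mem_set Xs))).
Proof. by eexists; last reflexivity. Qed.

Lemma represents_ex n s : Xn D n s -> exists x, represents n s x.
Proof. by move=> Xs; eexists; exact: (represents_inX Xs). Qed.

Lemma inX_eq n m (p : Xn D n) (q : Xn D m) : inX p = inX q <->
  exists i j, (n + i = m + j)%N /\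
    iter i (@embed k) (set_val p) = iter j (@embed k) (set_val q).
Proof.
split; first by move/eqmodP => /asboolP[i [j]]; exists i, j.
by move=> [i [j H]]; apply/eqmodP/asboolP; exists i, j.
Qed.

Lemma represents_level n m s t x : (n <= m)%N -> represents n s x ->
  (represents m t x <-> t = iter (m - n) (@embed k) s).
Proof.
move=> nm sx; have Xs := represents_Xn sx; have [p ps xp] := sx; split.
  move=> tx; have Xt := represents_Xn tx; have [q qt xq] := tx.
  have := xp; rewrite xq => /inX_eq [i [j []]]; rewrite ps qt => mn E.
  apply: esym; apply: (@iter_embed_inj m i) => //.
    by have := Xn_iter (m - n) Xs; rewrite subnK.
  by rewrite E -iterD; congr (iter _ _ _); lia.
move=> tE; have Xt : Xn D m t by have := Xn_iter (m - n) Xs; rewrite subnK// tE.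
exists (exist (fun z => z \in Xn D m) t (mem_set Xt)) => //.
rewrite xp; apply/inX_eq; exists (m - n)%N, 0%N; rewrite addn0 subnKC//.
by rewrite ps -tE set_valE.
Qed.

Lemma represents_uniq n s t x : represents n s x -> represents n t x -> s = t.
Proof.
by move=> sx /(represents_level _ (leqnn n) sx); rewrite subnn.
Qed.

Lemma represents_inj n s x y : represents n s x -> represents n s y -> x = y.
Proof. by move=> [p ps ->] [q qs ->]; apply/inX_eq; exists 0%N, 0%N; rewrite ps qs. Qed.

Lemma represents_some x : exists n s, represents n s x.
Proof.
elim/quotW : x => -[n p]; exists n, (set_val p); exists p => //.
Qed.

Lemma represents_up n m s x : (n <= m)%N -> represents n s x ->
  represents m (iter (m - n) (@embed k) s) x.
Proof. by move=> nm sx; apply/(represents_level _ nm sx). Qed.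

Lemma cylinderE n A x : cylinder D n A x <->
  exists2 s, represents n s x & s.1 \in A.
Proof.
split=> [[p pA xp]|[s [p ps xp] sA]]; first by exists (set_val p) => //; exists p.
by exists p => //; rewrite ps.
Qed.

Lemma XlevelE n x : Xlevel D n x <-> exists s, represents n s x.
Proof.
split=> [[p _ xp]|[s [p ps xp]]]; first by exists (set_val p), p.
by exists p.
Qed.

Lemma CFrelE g x y : CFrel D g x y <->
  exists n s, represents n s x /\ represents n (shift g s) y.
Proof.
split=> [[n [p [q [xp yq pq]]]]|[n [s [[p ps xp] [q qs yq]]]]].
  by exists n, (set_val p); split; [exists p|exists q].
by exists n, p, q; split => //; rewrite qs ps.
Qed.

Lemma Xn_shift n g s : Xn D n s -> translate g s.1 \in CF_F D n ->
  Xn D n (shift g s).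
Proof.
move=> [sF sC sP] gF; split => //= l.
by rewrite prodn_translate; have := sP l; case: prodn.
Qed.

(** Translation acts on the left and the embedding multiplies on the right, so the definitions of
    the action at different levels agree. *)
Lemma iter_embed_shift n m g s : Xn D n s ->
  iter m (@embed k) (shift g s) = shift g (iter m (@embed k) s).
Proof.
move=> Xs; elim: m => //= m ->; have := iter_embed_fst 1 (Xn_iter m Xs).
move: (iter m _ s) => t; rewrite /embed /shift /= pmul_translate.
by case: pmul.
Qed.

Lemma represents_shift_up n m g s x y : (n <= m)%N -> represents n s x ->
  represents n (shift g s) y ->
  exists2 t, represents m t x & represents m (shift g t) y.
Proof.
move=> nm sx sy; exists (iter (m - n) (@embed k) s).
  by apply/(represents_level _ nm sx).
by rewrite -(iter_embed_shift _ _ (represents_Xn sx)); exact: represents_up.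
Qed.

(** Both instances are lifted to a common level, where coordinates are unique. *)
Lemma CFrel_fun g x y z : CFrel D g x y -> CFrel D g x z -> y = z.
Proof.
move=> /CFrelE[n [s [sx sy]]] /CFrelE[m [t [tx tz]]].
have [s' s'x s'y] := represents_shift_up (leq_maxl n m) sx sy.
have [t' t'x t'z] := represents_shift_up (leq_maxr n m) tx tz.
rewrite -(represents_uniq s'x t'x) in t'z.
exact: represents_inj s'y t'z.
Qed.

Lemma shiftK g s : shift (- g) (shift g s) = s.
Proof. by case: s => -[f i] c; rewrite /shift /translate /= addKr. Qed.

Lemma CFrel_opp g x y : CFrel D g x y -> CFrel D (- g) y x.
Proof.
move=> /CFrelE[n [s [sx sy]]]; apply/CFrelE; exists n, (shift g s).
by split => //; rewrite shiftK.
Qed.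

Lemma CFactP g x y : CFrel D g x y -> CFact D g x = y.
Proof.
by move=> xy; apply: fun_of_rel_uniq => // u v; exact: CFrel_fun.
Qed.

Lemma CFact_out g x : ~ (exists y, CFrel D g x y) -> CFact D g x = x.
Proof.
move=> nxy; rewrite /CFact /fun_of_rel; apply: xgetPN => y xy.
by apply: nxy; exists y.
Qed.

Lemma CFact_represents n g s x : represents n s x ->
  translate g s.1 \in CF_F D n -> represents n (shift g s) (CFact D g x).
Proof.
move=> sx gF; have [y sy] := represents_ex (Xn_shift (represents_Xn sx) gF).
by rewrite (CFactP (y := y))//; apply/CFrelE; exists n, s.
Qed.

(* Replaces the tail of a point, keeping its image in [F_(m + n)]. *)
Lemma splice n m s t : Xn D n s -> Xn D (m + n) t ->
  (iter m (@embed k) s).1 = t.1 ->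
  exists s', [/\ Xn D n s', s'.1 = s.1,
    forall i, (i < m)%N -> s'.2 i = s.2 i & iter m (@embed k) s' = t].
Proof.
move=> Xs Xt st; have [sF sC sP] := Xs; have [tF tC tP] := Xt.
pose c i := if (i < m)%N then s.2 i else t.2 (i - m)%N.
have cs j : (j <= m)%N -> prodn s.1 c j = prodn s.1 s.2 j.
  by move=> jm; apply: eq_prodn => i ij; rewrite /c (leq_trans ij jm).
have ct i : c (m + i)%N = t.2 i by rewrite /c ltnNge leq_addr addKn.
have Xs' : Xn D n (s.1, c).
  split => //= [i|j].
    rewrite /c; case: ltnP => im; first exact: sC.
    by have := tC (i - m)%N; rewrite addnAC subnKC// addnC.
  have [jm|/ltnW mj] := leqP j m; first by rewrite cs.
  rewrite -(subnKC mj) prodn_add cs// (iter_embed_fst m Xs) /= st.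
  rewrite (_ : (fun i => _) = t.2); last by apply/funext => i; exact: ct.
  exact: tP.
exists (s.1, c); split => // [i im|]; first by rewrite /= /c im.
have := iter_embed_fst m Xs'; rewrite /= cs// (iter_embed_fst m Xs) st => -[E].
rewrite [LHS]surjective_pairing [RHS]surjective_pairing E; congr pair.
by apply/funext => i; rewrite iter_embed_snd; exact: ct.
Qed.

(** When [n <= m], the level [m] coordinate is a product of [s.1] and [m - n] further terms. When
    [m < n], splicing the tail of [y] onto the coordinates of [x] at level [m] gives coordinates of
    [y] with the same first component. *)
Lemma represents_cylinder n m s t x y A : represents n s x -> represents n t y ->
  s.1 = t.1 -> (forall i, (i < m)%N -> s.2 i = t.2 i) ->
  cylinder D m A x -> cylinder D m A y.
Proof.
move=> sx ty st1 st2 /cylinderE[r rx rA]; apply/cylinderE.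
have [nm|mn] := leqP n m.
  have rE := (represents_level _ nm sx).1 rx.
  exists (iter (m - n) (@embed k) t); first exact: represents_up.
  have := iter_embed_fst (m - n) (represents_Xn ty).
  rewrite -st1 -(@eq_prodn _ s.2); last first.
    by move=> i im; apply: st2; rewrite (leq_trans im) ?leq_subr.
  by rewrite (iter_embed_fst _ (represents_Xn sx)) -rE => -[<-].
have sE := (represents_level _ (ltnW mn) rx).1 sx.
have Xt : Xn D ((n - m) + m) t by rewrite subnK ?(ltnW mn)//; exact: represents_Xn ty.
have [|r' [Xr' r'1 _ r't]] := splice (represents_Xn rx) Xt; first by rewrite -sE.
have [z r'z] := represents_ex Xr'; exists r'; last by rewrite r'1.
have := represents_up (ltnW mn) r'z; rewrite r't => tz.
by rewrite (represents_inj ty tz).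
Qed.

(** The levels of the towers of stage [n] that meet X_0; by [represents_base] such levels lie
    entirely in X_0. *)
Definition base n : {fset G' k} := [fset f in CF_F D n |
  `[< exists2 s, s.1 = f & exists2 x, represents n s x & Xlevel D 0 x >]]%fset.

Lemma base_subset n : (base n `<=` CF_F D n)%fset.
Proof. exact: fset_sub. Qed.

Lemma Xlevel0_cylinder : Xlevel D 0 = cylinder D 0 (CF_F D 0).
Proof.
apply/seteqP; split => x.
  move=> /XlevelE[s sx]; apply/cylinderE; exists s => //.
  by have [] := represents_Xn sx.
by move=> /cylinderE[s sx _]; apply/XlevelE; exists s.
Qed.

(** X_0 is a cylinder of level 0, so by [represents_cylinder] membership in it depends on the first
    component alone. *)
Lemma represents_base n s x : represents n s x ->
  (Xlevel D 0 x <-> s.1 \in base n).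
Proof.
move=> sx; rewrite !inE; split.
  move=> x0; apply/andP; split; first by have [] := represents_Xn sx.
  by apply/asboolP; exists s => //; exists x.
move=> /andP[_ /asboolP[t ts [y ty y0]]]; rewrite Xlevel0_cylinder in y0 *.
by apply: represents_cylinder ty sx ts _ y0.
Qed.

Lemma Xlevel_subset n m : (n <= m)%N -> Xlevel D n `<=` Xlevel D m.
Proof.
move=> nm x /XlevelE[s sx]; apply/XlevelE.
by eexists; exact: represents_up nm sx.
Qed.

Lemma Xlevel0_base n : Xlevel D 0 = cylinder D n (base n).
Proof.
apply/seteqP; split => x.
  move=> x0; have /XlevelE[s sx] := Xlevel_subset (leq0n n) x0.
  by apply/cylinderE; exists s => //; apply/(represents_base sx).
by move=> /cylinderE[s sx] /(represents_base sx).
Qed.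

Lemma in_Fslice (A : {fset G' k}) i f :
  (f \in Fslice A i) = (f \in A) && (f.2 == i).
Proof. by rewrite /Fslice !inE. Qed.

Lemma Xlevel0_slice n j : Xlevel D 0 `&` cylinder D n (Fslice (CF_F D n) j) =
  cylinder D n (Fslice (base n) j).
Proof.
apply/seteqP; split => x.
  move=> [x0 /cylinderE[s sx]]; rewrite in_Fslice => /andP[sF sj].
  apply/cylinderE; exists s => //; rewrite in_Fslice sj andbT.
  exact/(represents_base sx).
move=> /cylinderE[s sx]; rewrite in_Fslice => /andP[/= sb sj]; split.
  exact/(represents_base sx).
apply/cylinderE; exists s => //; rewrite in_Fslice sj andbT.
by have [] := represents_Xn sx.
Qed.

(** In every X_m, membership in the cylinder is decided by [s.1] and the first [n] terms, that is,
    by finitely many discrete coordinates. *)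
Lemma open_cylinder n A : open (cylinder D n A).
Proof.
apply/sigT_openP => m; rewrite openE => p pA.
pose V := [set t : seq_ambient k | t.1 = (set_val p).1 /\
  forall i, (i < n)%N -> t.2 i = (set_val p).2 i].
pose c0 : prod_topology (fun _ : nat => discrete_topology (G'' k)) := (set_val p).2.
have V2 j : nbhs c0 [set c | forall i, (i < j)%N -> c i = c0 i].
  elim: j => [|j IH]; first exact: (@filterS _ _ (nbhs_filter c0) setT _ _ filterT).
  have Vj : nbhs c0 [set c | c j = c0 j].
    have H := @proj_continuous nat (fun=> discrete_topology (G'' k)) j c0.
    exact: (H [set c0 j] (discrete_set1 (c0 j))).
  apply: (@filterS2 _ _ (nbhs_filter c0) _ _ _ _ IH Vj) => c ci cj i.
  rewrite ltnS leq_eqVlt => /predU1P[->//|].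
  exact: ci.
have oV : nbhs (set_val p) V.
  exists ([set (set_val p).1], [set c | forall i, (i < n)%N -> c i = c0 i]).
    by split => /=; [exact: discrete_set1|exact: V2].
  by move=> t /= [].
have : nbhs p (set_val @^-1` V) by exact: (@initial_continuous _ _ set_val p).
apply: filterS => q [q1 q2].
apply: (@represents_cylinder m n (set_val p) (set_val q) (inX p) (inX q)) => //.
- by exists p.
- by exists q.
- by move=> i im; rewrite q2.
Qed.

End level_points.

(** * Returns to X_0 of a (C,F)-action *)

Section CF_counting.
Context (k : nat) (D : CF_data k).
Implicit Types (x : CFspace D).

Lemma min_height_le l i : (min_height D l <= #|` Fslice (CF_F D l) i|)%N.
Proof.
rewrite /min_height; have : i \in index_enum 'I_k by rewrite mem_index_enum.
elim: (index_enum _) => // j r IH; rewrite inE big_cons geq_min.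
by move=> /predU1P[<-|/IH ->]; rewrite ?leqnn ?orbT.
Qed.

Lemma min_height_attained l : exists i, min_height D l = #|` Fslice (CF_F D l) i|.
Proof.
have [E|//] : min_height D l = #|` CF_F D l| \/
    exists i, min_height D l = #|` Fslice (CF_F D l) i|.
  rewrite /min_height; apply: (big_ind (fun v => v = #|` CF_F D l| \/
    exists i, v = #|` Fslice (CF_F D l) i|)); first by left.
    by move=> a b Ha Hb; rewrite /minn; case: ifP.
  by move=> i _; right; exists i.
(* If the default value is attained, no slice can be smaller than the whole of [CF_F D l], so any
   index will do. *)
exists (Ordinal (CF_k_gt0 D)); apply/eqP; rewrite eqn_leq min_height_le E.
by apply: fsubset_leq_card; exact: fset_sub.
Qed.

Lemma CF_F_bounds l (f : G' k) : f \in CF_F D l ->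
  0 <= f.1 < (#|` Fslice (CF_F D l) f.2|)%:Z.
Proof. by case: f => g i; rewrite CF_finite_rank. Qed.

Lemma mem_CF_F l (f : G' k) : 0 <= f.1 < (#|` Fslice (CF_F D l) f.2|)%:Z ->
  f \in CF_F D l.
Proof. by case: f => g i /=; rewrite CF_finite_rank. Qed.

Section orbit.
Context (x : CFspace D)
  (xD : forall g h, CFact D (g + h) x = CFact D g (CFact D h x)).
Let orb (m : nat) := CFact D m%:Z x.

Let orb_shift l s (m m' : nat) : represents l s (orb m) ->
  translate (m'%:Z - m%:Z) s.1 \in CF_F D l ->
  represents l (shift (m'%:Z - m%:Z) s) (orb m').
Proof.
move=> sm F; have := CFact_represents sm F.
by rewrite /orb -xD subrK.
Qed.

(** Times spent in the same passage through a tower correspond to distinct levels of that tower, and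
    visits to X_0 to levels in [base]. The law of the action is assumed only along the orbit of [x],
    as it holds almost everywhere for a (C,F)-action. *)
Lemma card_block n (V : {set 'I_n}) l s (m0 : nat) : represents l s (orb m0) ->
  (forall m, m \in V -> Xlevel D 0 (orb m)) ->
  (forall m, m \in V -> translate (m%:Z - m0%:Z) s.1 \in CF_F D l) ->
  (#|V| <= #|` Fslice (base D l) s.1.2|)%N.
Proof.
move=> sm VX VF.
pose phi (m : 'I_n) := translate (m%:Z - m0%:Z) s.1.
have -> : #|V| = size (map phi (enum V)) by rewrite size_map -cardE.
apply: uniq_leq_size.
  rewrite map_inj_uniq ?enum_uniq// => a b [] /addIr /addIr [ab].
  exact: val_inj.
move=> f /mapP[m]; rewrite mem_enum => mV ->.
rewrite in_Fslice /= eqxx andbT.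
by have /(represents_base) <- := orb_shift sm (VF _ mV); exact: VX.
Qed.

(** The visits are split into those in the same tower passage as the first visit [m0], and the
    others. The first visit [m1] of the second kind starts a passage that lasts until the end of the
    window, so two blocks suffice. *)
Lemma card_visits l n N : (n <= min_height D l)%N ->
  (forall j, #|` Fslice (base D l) j| <= N)%N ->
  (#|[set m : 'I_n | orb m \in Xlevel D 0]%SET| <= N.*2)%N.
Proof.
move=> nh HN; set V := [set m : 'I_n | _]%SET.
have VX (m : 'I_n) : m \in V -> Xlevel D 0 (orb m) by rewrite inE => /set_mem.
have rep (m : 'I_n) : m \in V ->
    exists2 s, represents l s (orb m) & s.1 \in CF_F D l.
  move=> /VX; rewrite (Xlevel0_base D l) => /cylinderE[s sm sb]; exists s => //.
  exact: (fsubsetP (base_subset D l)).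
have [->|[m mV]] := set_0Vmem V; first by rewrite cards0.
have [m0 m0V m0min] := arg_minnP (@nat_of_ord n) mV => {m mV}.
have [s0 s0m s0F] := rep _ m0V.
pose V1 := [set m in V | translate (m%:Z - m0%:Z) s0.1 \in CF_F D l]%SET.
rewrite -(cardsID V1 V) -addnn leq_add//.
  apply: leq_trans (HN s0.1.2); apply: (card_block s0m) => m.
    by rewrite inE => /andP[/VX].
  by rewrite !inE => /and3P[].
have [->|[m mV]] := set_0Vmem (V :\: V1); first by rewrite cards0.
have [m1 m1V m1min] := arg_minnP (@nat_of_ord n) mV => {m mV}.
have [m1V' m1V1] := finset.setDP m1V.
have [s1 s1m s1F] := rep _ m1V'.
apply: leq_trans (HN s1.1.2); apply: (card_block s1m) => m mV.
  by have [/VX] := finset.setDP mV.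
have m01 : (m0 <= m1)%N by exact: m0min.
have m1m : (m1 <= m)%N by exact: m1min.
have /andP[f1_ge f1_lt] := CF_F_bounds s1F.
(* Otherwise going back from time [m1] to time [m0] would not leave the tower, and [m1] would belong
   to [V1]. *)
have f1small : s1.1.1 < m1%:Z - m0%:Z.
  rewrite ltNge; apply/negP => f1big.
  have F01 : translate (m0%:Z - m1%:Z) s1.1 \in CF_F D l.
    apply: mem_CF_F; rewrite /translate /=; apply/andP; split; first by lia.
    by apply: le_lt_trans f1_lt; lia.
  have s01 := represents_uniq s0m (orb_shift s1m F01).
  have : m1 \in V1.
    rewrite inE m1V' s01 /=; have := shiftK (m0%:Z - m1%:Z) s1.
    by rewrite opprB => /(congr1 fst) /= ->.
  exact/negP.
(* At time [m] the position in the tower is [s1.1.1 + (m - m1)], less than [m - m0] and hence less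
   than the smallest height. *)
have mn := ltn_ord m; have mh := min_height_le l s1.1.2.
apply: mem_CF_F; rewrite /translate /=; apply/andP; split; first by lia.
by apply: (@lt_le_trans _ _ (min_height D l)%:Z); [lia|rewrite lez_nat].
Qed.

Lemma visits_bound (R : realType) l N :
  (forall j, #|` Fslice (base D l) j| <= N)%N ->
  visits R (CFact D) (Xlevel D 0) (min_height D l) x <= (N.*2)%:R.
Proof.
move=> HN; rewrite /visits big_mkord.
under eq_bigr do rewrite indicE.
rewrite -natr_sum ler_nat.
have := card_visits (leqnn (min_height D l)) HN; apply: leq_trans.
rewrite -sum1dep_card [leqRHS]big_mkcond /=.
by apply: leq_sum => i _; case: (_ \in _).
Qed.

End orbit.

Definition returning l i (m : nat) : {fset G' k} :=
  [fset f in Fslice (base D l) i | translate m%:Z f \in base D l]%fset.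

Lemma in_returning l i m f : (f \in returning l i m) =
  (f \in Fslice (base D l) i) && (translate m%:Z f \in base D l).
Proof. by rewrite /returning !inE. Qed.

(* Each pair of levels of a tower is counted once, apart from the order. *)
Lemma card_returning l i : (#|` Fslice (base D l) i| ^ 2 <=
  (\sum_(0 <= m < #|` Fslice (CF_F D l) i|) #|` returning l i m|).*2)%N.
Proof.
set B := Fslice (base D l) i; set h := #|` Fslice (CF_F D l) i|.
have BF f : f \in B -> [/\ f \in base D l, f.2 = i & 0 <= f.1 < h%:Z].
  rewrite in_Fslice => /andP[fb /eqP fi]; split => //.
  have := CF_F_bounds (fsubsetP (base_subset D l) _ fb); rewrite fi.
  exact.
(* A level [f'] at or above [f] is the translate of [f] by [f'.1 - f.1], which is smaller than the
   height. *)
have count_le f : f \in B -> (count (fun f' : G' k => f.1 <= f'.1)%R B <=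
    \sum_(0 <= m < h) (translate m%:Z f \in base D l))%N.
  move=> /BF[fb fi /andP[f0 fh]].
  rewrite /index_iota subn0 -sum1_count big_mkcond /= -big_mkcond sum1_count.
  rewrite -!size_filter (_ : (\sum_(m <- iota 0 h) _)%N =
    size (seq.filter (fun m => translate m%:Z f \in base D l) (iota 0 h))); last first.
    rewrite size_filter -sum1_count [RHS]big_mkcond /=.
    by apply: eq_bigr => m _; case: (_ \in _).
  set s := seq.filter _ B.
  rewrite -(size_map (fun f' : G' k => `|f'.1 - f.1|%N) s).
  apply: uniq_leq_size.
    rewrite map_inj_in_uniq ?filter_uniq ?fset_uniq//.
    move=> [a ia] [b ib]; rewrite !mem_filter => /andP[/= fa /BF[_ /= -> _]].
    by move=> /andP[/= fb' /BF[_ /= -> _]] ab; congr pair; lia.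
  move=> m /mapP[[a ia]]; rewrite mem_filter => /andP[/= fa /BF[ab /= ia' /andP[a0 ah]]] ->.
  rewrite mem_filter mem_iota /= add0n; apply/andP; split; last first.
    by rewrite -ltz_nat gez0_abs ?subr_ge0//; apply: le_lt_trans ah; rewrite gerBl.
  rewrite (_ : translate _ _ = (a, ia))// /translate ia' -fi; congr pair.
  by case: f {fb fi f0 fh s} fa => f j /= fa; lia.
have ret m : (\sum_(f <- B) (translate m%:Z f \in base D l) <= #|` returning l i m|)%N.
  rewrite (_ : (\sum_(f <- B) _)%N =
    size (seq.filter (fun f => translate m%:Z f \in base D l) B)); last first.
    rewrite size_filter -sum1_count [RHS]big_mkcond /=.
    by apply: eq_bigr => f _; case: (_ \in _).
  apply: uniq_leq_size; first by rewrite filter_uniq ?fset_uniq.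
  move=> f; rewrite mem_filter => /andP[h1 h2].
  by rewrite in_returning; apply/andP; split.
apply: (@leq_trans (\sum_(f <- B) count (fun f' : G' k => f.1 <= f'.1)%R B).*2); last first.
  rewrite leq_double.
  apply: (@leq_trans (\sum_(0 <= m < h) \sum_(f <- B)
      (translate m%:Z f \in base D l))%N); last first.
    by apply: leq_sum => m _; exact: ret.
  rewrite exchange_big /= big_seq [leqRHS]big_seq.
  by apply: leq_sum => f /count_le.
have cE (P : rel (G' k)) : (\sum_(f <- B) count (P f) B =
    \sum_(f <- B) \sum_(f' <- B) P f f')%N.
  apply: eq_bigr => f _; rewrite -sum1_count big_mkcond /=.
  by apply: eq_bigr => f' _; case: P.
(* One of the two copies of the sum has its variables exchanged; since any two positions are
   comparable, together they cover all ordered pairs. *)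
rewrite (cE (fun f f' => f.1 <= f'.1)%R) -addnn [X in (_ <= _ + X)%N]exchange_big /=.
rewrite -big_split /= -mulnn -sum1_size big_distrl /=.
apply: leq_sum => f _; rewrite mul1n -big_split /=.
by apply: leq_sum => f' _; case: leP => //= h'; rewrite ?leq_addr// ltW.
Qed.

End CF_counting.

(** * Measures of returns to X_0 *)

Section CF_measure_theory.
Context (R : realType) (k : nat) (D : CF_data k)
  (mu : {measure set (CFborel D) -> \bar R}) (lambda : nat -> 'cV[R]_k).

Lemma measurable_cylinder n A : measurable (cylinder D n A : set (CFborel D)).
Proof. by apply: sub_gen_smallest; exact: open_cylinder. Qed.

Lemma measurable_Xlevel0 : measurable (Xlevel D 0 : set (CFborel D)).
Proof. by rewrite Xlevel0_cylinder; exact: measurable_cylinder. Qed.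

Definition CFdom (g : int) : set (CFborel D) := [set x | exists y, CFrel D g x y].

(** [T_g] is defined at a point exactly when, at some level, its first coordinate and the translate
    by [g] both lie in [CF_F D n]. *)
Lemma measurable_CFdom g : measurable (CFdom g).
Proof.
have -> : CFdom g = \bigcup_n cylinder D n
    [fset f in CF_F D n | translate g f \in CF_F D n]%fset.
  apply/seteqP; split => x.
    move=> [y /CFrelE[n [s [sx sy]]]]; exists n => //; apply/cylinderE.
    exists s => //; rewrite !inE /=; have [-> _ _] := represents_Xn sx.
    by have [] := represents_Xn sy.
  move=> [n _ /cylinderE[s sx]]; rewrite !inE /= => /andP[sF gF].
  exists (CFact D g x); apply/CFrelE; exists n, s; split => //.
  exact: CFact_represents.
by apply: bigcup_measurable => n _; exact: measurable_cylinder.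
Qed.

(** The action is extended by the identity, so an image consists of a genuine part and of the points
    of [B] left fixed outside of the domain. *)
Lemma CFact_image (m : int) (B : set (CFborel D)) : CFact D m @` B =
  (CFdom (- m) `&` CFact D (- m) @^-1` B) `|` (B `\` CFdom m).
Proof.
apply/seteqP; split => y.
  move=> [x Bx <-]; have [[z xz]|nxz] := pselect (CFdom m x).
    have zx := CFrel_opp xz; left; rewrite (CFactP xz); split; first by exists x.
    by rewrite /preimage /= (CFactP zx).
  by right; rewrite CFact_out.
move=> [[[x yx]]|[By ny]]; last by exists y => //; rewrite CFact_out.
rewrite /preimage /= (CFactP yx) => Bx; exists x => //.
by have := CFrel_opp yx; rewrite opprK => /CFactP.
Qed.

Context (def_ae : CF_defined_ae mu) (actT : measure_preserving_action mu (CFact D)).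

Let mT g : measurable_fun setT (CFact D g : CFborel D -> CFborel D).
Proof. by case: actT. Qed.

Let mpre g A : measurable A ->
  measurable ((CFact D g : CFborel D -> CFborel D) @^-1` A).
Proof. by move=> mA; rewrite -[X in measurable X]setTI; exact: mT. Qed.

Lemma measure_CFact_image (m : int) (A B : set (CFborel D)) :
  measurable A -> measurable B ->
  mu (A `&` CFact D m @` B) = mu (A `&` CFact D (- m) @^-1` B).
Proof.
move=> mA mB; rewrite CFact_image; apply: measure_ae_eq.
- apply: measurableI => //; apply: measurableU.
    by apply: measurableI; [exact: measurable_CFdom|exact: mpre].
  by apply: measurableD => //; exact: measurable_CFdom.
- by apply: measurableI => //; exact: mpre.
- have [N [mN N0 NP]] := ae_forall_countable def_ae.
  exists N; split => // x nx; apply: NP => dx; apply: nx.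
  have := dx m; have := dx (- m).
  rewrite /setI /setU /setD /CFdom /preimage /=; tauto.
Qed.

Context (CFm : CF_measure mu lambda).

Let lambda_ge0 n i : 0 <= lambda n i ord0. Proof. by case: CFm. Qed.
Let mu_cyl n (A : {fset G' k}) : (A `<=` CF_F D n)%fset -> mu (cylinder D n A) =
  (\sum_(i < k) (#|` Fslice A i|)%:R * lambda n i ord0)%:E.
Proof. by case: CFm => _ _ _; exact. Qed.

Lemma measure_base_slice n i : mu (cylinder D n (Fslice (base D n) i)) =
  ((#|` Fslice (base D n) i|)%:R * lambda n i ord0)%:E.
Proof.
rewrite mu_cyl; last first.
  by apply: fsubset_trans (base_subset D n); exact: fset_sub.
rewrite (bigD1 i)//= big1 ?addr0; last first.
  move=> j ji; rewrite (_ : Fslice _ j = fset0) ?cardfs0 ?mul0r//.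
  apply/fsetP => f; rewrite !in_Fslice inE; apply/negbTE/negP.
  by move=> /andP[/andP[_ /eqP fi] /eqP fj]; move/eqP: ji; apply; rewrite -fj.
congr (_%:R * _)%:E; congr (#|` _|); apply/fsetP => f.
by rewrite !in_Fslice -andbA andbb.
Qed.

Lemma measure_Xlevel0 n : mu (Xlevel D 0) =
  (\sum_(i < k) (#|` Fslice (base D n) i|)%:R * lambda n i ord0)%:E.
Proof. by rewrite (Xlevel0_base D n) mu_cyl//; exact: base_subset. Qed.

Definition return_total l : R := \sum_(0 <= m < min_height D l)
  fine (mu (Xlevel D 0 `&` CFact D m%:Z @^-1` Xlevel D 0)).

Context (X01 : mu (Xlevel D 0) = 1%E).

Let Xfin (B : set (CFborel D)) : measurable B -> mu (Xlevel D 0 `&` B) \is a fin_num.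
Proof.
move=> mB; rewrite ge0_fin_numE//; apply: (@le_lt_trans _ _ (mu (Xlevel D 0))).
  by apply: le_measure; rewrite ?inE//; [apply: measurableI => //|];
    exact: measurable_Xlevel0.
by rewrite X01 ltry.
Qed.

(** The levels in [returning D l i m] lie in X_0 together with their translates by [m], and each has
    measure [lambda l i ord0]. As tower [i] is the shortest, [m] runs through all the differences
    counted in [card_returning]. *)
Lemma return_total_ge l i : min_height D l = #|` Fslice (CF_F D l) i| ->
  lambda l i ord0 * (#|` Fslice (base D l) i|)%:R ^+ 2 <= 2 * return_total l.
Proof.
move=> hE; have := card_returning D l i; rewrite -hE -(ler_nat R) => H.
rewrite -natrX; apply: le_trans (ler_wpM2l (lambda_ge0 l i) H) _.
rewrite -muln2 natrM mulrA [leRHS]mulrC ler_wpM2r//.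
rewrite natr_sum mulr_sumr; apply: ler_sum => m _.
rewrite -lee_fin fineK; last by apply: Xfin; apply: mpre; exact: measurable_Xlevel0.
have retE : Fslice (returning D l i m) i = returning D l i m.
  apply/fsetP => f; rewrite in_Fslice; apply/andb_idr.
  by rewrite in_returning in_Fslice => /andP[/andP[]].
have ret_sub : (returning D l i m `<=` base D l)%fset.
  by apply/fsubsetP => f; rewrite in_returning in_Fslice => /andP[/andP[]].
apply: (@le_trans _ _ (mu (cylinder D l (returning D l i m)))).
  rewrite mu_cyl; last by apply: fsubset_trans (base_subset D l).
  rewrite lee_fin (bigD1 i)//= retE mulrC lerDl; apply: sumr_ge0 => j _.
  by rewrite mulr_ge0.
apply: le_measure; rewrite ?inE.
- exact: measurable_cylinder.
- by apply: measurableI; [|apply: mpre]; exact: measurable_Xlevel0.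
move=> x /cylinderE[s sx sr]; split.
  by apply/(represents_base sx); exact: (fsubsetP ret_sub).
have tb : translate m%:Z s.1 \in base D l.
  by move: sr; rewrite in_returning => /andP[].
have := CFact_represents sx (fsubsetP (base_subset D l) _ tb).
by move=> /represents_base H'; apply/H'.
Qed.

End CF_measure_theory.

(** * Topology of the (C,F)-space and measurability of the action *)

Section CF_action.
Context (k : nat) (D : CF_data k).

Let prodC := prod_topology (fun _ : nat => discrete_topology (G'' k)).

(** The filter generated by the initial segments of [c] converges to [c] in every coordinate, hence
    in the product topology. *)
Lemma nbhs_initial_segment (c : prodC) (Q : set prodC) : nbhs c Q ->
  exists j, forall c' : prodC, (forall i, (i < j)%N -> c' i = c i) -> Q c'.
Proof.
pose F := filter_from [set: nat]
  (fun j => [set c' : prodC | forall i, (i < j)%N -> c' i = c i]).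
have FF : Filter F.
  apply: filter_from_filter; first by exists 0%N.
  move=> i j _ _; exists (maxn i j) => // c' H; split => l lt; apply: H;
    by rewrite (leq_trans lt) ?leq_maxl ?leq_maxr.
have Fc : F --> c.
  apply/cvg_sup => i; apply/cvg_image.
    by rewrite eqEsubset; split => // v _; exists (fun=> v).
  move=> V Vc; exists (fun c' : prodC => V (c' i)).
    exists i.+1 => // c' /(_ i (ltnSn i)) /= ->; exact: nbhs_singleton Vc.
  apply/seteqP; split => [_ [c' Vc' <-]|v Vv]; first exact: Vc'.
  by exists (fun=> v).
by move=> /Fc [j _ H]; exists j => c' /H.
Qed.

(** Near a point of X_n, an open set contains all sequences with the same [f] and the same first [j]
    terms. At level [j + n] these terms are absorbed into the first coordinate, and [splice] shows
    that the whole cylinder over it lies in the set. *)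
Lemma open_countable_cylinders (U : set (CFspace D)) : open U ->
  U = \bigcup_n cylinder D n [fset f in CF_F D n |
    `[< (cylinder D n [fset f]%fset `<=` U)%classic >]]%fset.
Proof.
move=> oU; apply/seteqP; split => x; last first.
  move=> [n _ /cylinderE[s sx]]; rewrite !inE /= => /andP[_ /asboolP]; apply.
  by apply/cylinderE; exists s => //; rewrite inE.
move=> Ux; have [n [s [p ps xp]]] := represents_some x.
have : nbhs p ((@inX k D n) @^-1` U).
  have /sigT_openP /(_ n) oUn : open ((fun z => \pi_(CFspace D)%qT z) @^-1` U) by exact: oU.
  by apply: open_nbhs_nbhs; split => //; rewrite /preimage /= -xp.
move=> [W [[W0 oW0 <-] Wp WU]].
have [[P Q] /= [Pp Qp] PQ] : nbhs (set_val p) W0 by exact: open_nbhs_nbhs.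
have [j Hj] := nbhs_initial_segment Qp.
have sx : represents n s x by exists p.
have up := represents_up (leq_addl j n) sx; rewrite addnK in up.
exists (j + n)%N => //; apply/cylinderE.
eexists; first exact: up; rewrite !inE /=.
apply/andP; split; first by have [] := represents_Xn up.
apply/asboolP => y /cylinderE[t ty]; rewrite inE => /eqP t1.
have [s' [Xs' s'1 s'2 s't]] := splice (represents_Xn sx) (represents_Xn ty) (esym t1).
have [z s'z] := represents_ex Xs'.
have := represents_up (leq_addl j n) s'z; rewrite addnK s't => tz.
rewrite (represents_inj ty tz); have [q qs' ->] := s'z.
have PQq : (P `*` Q) (set_val q).
  rewrite qs'; split; first by rewrite s'1 -ps; exact: nbhs_singleton.
  by apply: Hj => i ij; rewrite s'2// ps.
exact: (WU q (PQ _ PQq)).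
Qed.

Lemma measurable_CFact g :
  measurable_fun setT (CFact D g : CFborel D -> CFborel D).
Proof.
(* These are the points sent into a cylinder of level [n]. At a level [m >= n] where [T_g] is
   visible, the first coordinate decides membership, so the set is a countable union of
   cylinders. *)
pose A n f := [set x : CFborel D |
  exists2 y, CFrel D g x y & cylinder D n [fset f]%fset y].
have mA n f : measurable (A n f).
  have -> : A n f = \bigcup_m cylinder D m [fset f' in CF_F D m |
      `[< exists s (x y : CFspace D), [/\ (n <= m)%N, s.1 = f', represents m s x,
         represents m (shift g s) y & cylinder D n [fset f]%fset y] >]]%fset.
    apply/seteqP; split => x.
      move=> [y /CFrelE[m [s [sx sy]]] yf].
      have [t tx ty] := represents_shift_up (leq_maxl m n) sx sy.
      exists (maxn m n) => //; apply/cylinderE; exists t => //.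
      rewrite !inE /=; apply/andP; split; first by have [] := represents_Xn tx.
      by apply/asboolP; exists t, x, y; split => //; exact: leq_maxr.
    move=> [m _ /cylinderE[t tx]]; rewrite !inE /= => /andP[tF /asboolP].
    move=> [s [x' [y' [nm st sx' sy' y'f]]]].
    have F : translate g t.1 \in CF_F D m.
      by have [] := represents_Xn sy'; rewrite /= st.
    have ty := CFact_represents tx F.
    exists (CFact D g x); first by apply/CFrelE; exists m, t.
    move: y'f => /cylinderE[r ry' rf].
    have E := (represents_level _ nm ry').1 sy'.
    have Xt : Xn D ((m - n) + n) (shift g t).
      by rewrite subnK//; exact: represents_Xn ty.
    have [|r' [Xr' r'1 _ r't]] := splice (represents_Xn ry') Xt.
      by rewrite -E /= st.
    have [z r'z] := represents_ex Xr'.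
    have := represents_up nm r'z; rewrite r't => /(represents_inj ty) yz.
    by apply/cylinderE; exists r'; [rewrite yz|rewrite r'1].
  by apply: bigcup_measurable => m _; exact: measurable_cylinder.
apply: (@measurability _ _ (CFborel D) (CFborel D) setT _ (@open (CFspace D))) => //.
move=> _ [U oU <-]; rewrite setTI.
pose I := (nat * G' k)%type.
have -> : CFact D g @^-1` U =
    (\bigcup_(i in [set i : I | cylinder D i.1 [fset i.2]%fset `<=` U]) A i.1 i.2) `|`
    (U `\` @CFdom k D g).
  apply/seteqP; split => x.
    rewrite /preimage /= => Ux; have [[y xy]|nx] := pselect (@CFdom k D g x).
      left; move: Ux; rewrite (CFactP xy) => Uy.
      move: Uy; rewrite [X in X y -> _](open_countable_cylinders oU).
      move=> [n _ /cylinderE[s sy]]; rewrite !inE /= => /andP[_ /asboolP sU].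
      exists (n, s.1) => //=; exists y => //.
      by apply/cylinderE; exists s => //; rewrite inE.
    by right; split => //; move: Ux; rewrite CFact_out.
  move=> [[[n f] /= fU [y xy yf]]|[Ux nx]].
    by rewrite /preimage /= (CFactP xy); exact: fU.
  by rewrite /preimage /= CFact_out.
apply: measurableU; last first.
  apply: measurableD; last exact: measurable_CFdom.
  by apply: sub_gen_smallest.
rewrite bigcup_mkcond.
apply: countable_bigcupT_measurable => [|i]; first exact: countableP.
by case: ifP.
Qed.

Lemma CFact0 x : CFact D 0 x = x.
Proof.
have [n [s sx]] := represents_some x; apply: CFactP; apply/CFrelE; exists n, s.
by split => //; rewrite /shift /translate; case: s sx => -[f i] c; rewrite add0r.
Qed.

Lemma CFactD g h x : @CFdom k D h x -> @CFdom k D (g + h) x ->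
  CFact D (g + h) x = CFact D g (CFact D h x).
Proof.
move=> [y xy] [z xz]; rewrite (CFactP xy) (CFactP xz); apply/esym/CFactP.
have [n [s [sx sy]]] := (CFrelE _ _ _).1 xy.
have [m [t [tx tz]]] := (CFrelE _ _ _).1 xz.
have [s' s'x s'y] := represents_shift_up (leq_maxl n m) sx sy.
have [t' t'x t'z] := represents_shift_up (leq_maxr n m) tx tz.
have st := represents_uniq s'x t'x; rewrite -st in t'z.
apply/CFrelE; exists (maxn n m), (shift h s'); split => //.
suff -> : shift g (shift h s') = shift (g + h) s' by [].
by rewrite /shift /translate /= addrA.
Qed.

Lemma CFact_preserving (R : realType) (mu : {measure set (CFborel D) -> \bar R}) :
  CF_defined_ae mu ->
  (forall g (A : set (CFborel D)), measurable A -> mu (CFact D g @^-1` A) = mu A) ->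
  measure_preserving_action mu (CFact D).
Proof.
move=> def_ae pT; have [N [mN N0 NP]] := ae_forall_countable def_ae.
split => //.
- by move=> g; exact: measurable_CFact.
- by apply: aeW => x; exact: CFact0.
- move=> g h; exists N; split => // x nx; apply: NP => dx; apply: nx.
  by apply: CFactD; exact: dx.
Qed.

End CF_action.

(** The inverse of a sum that dominates each [(F i)^-1]; the summand 1 keeps it positive when the
    index type is empty. *)
Lemma positive_lower_bound (R : realFieldType) (I : finType) (F : I -> R) :
  (forall i, 0 < F i) -> exists2 c, 0 < c & forall i, c <= F i.
Proof.
move=> F0; exists (1 + \sum_i (F i)^-1)^-1.
  rewrite invr_gt0 ltr_pwDl// sumr_ge0// => i _.
  by rewrite invr_ge0 ltW.
move=> i; rewrite -[leRHS]invrK lef_pV2 ?posrE ?invr_gt0//; last first.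
  by rewrite ltr_pwDl// sumr_ge0// => j _; rewrite invr_ge0 ltW.
rewrite (bigD1 i)//= addrCA lerDl addr_ge0// sumr_ge0// => j _.
by rewrite invr_ge0 ltW.
Qed.

Lemma halving_cvg0 (R : realType) (u : nat -> R) : (forall n, 0 <= u n) ->
  (\forall n \near \oo, 2 * u n.+1 <= u n) -> u @ \oo --> (0 : R).
Proof.
move=> u0 [N _ HN]; rewrite -(cvg_shiftn N).
have H n : u (n + N)%N <= geometric (u N) (2^-1) n.
  elim: n => [|n IH]; first by rewrite /= expr0 mulr1.
  have := HN (n + N)%N (leq_addl _ _); rewrite /= => H.
  rewrite addSn exprS mulrCA ler_pdivlMl//.
  exact: le_trans IH.
apply: (@squeeze_cvgr _ _ _ _ (cst 0) (geometric (u N) 2^-1) _).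
- by apply: nearW => n; rewrite u0 H.
- exact: cvg_cst.
- by apply: cvg_geometric; rewrite ger0_norm// invf_lt1// ltr1n.
Qed.

(** * Bounded returns in balanced finite rank *)

Section balanced_returns.
Context (R : realType) (k : nat) (D : CF_data k)
  (mu : {measure set (CFborel D) -> \bar R}) (lambda : nat -> 'cV[R]_k).
Context (bal : balanced_CF mu lambda)
  (actT : measure_preserving_action mu (CFact D)).

Let CFm : CF_measure mu lambda. Proof. by case: bal. Qed.
Let X01 : mu (Xlevel D 0) = 1%E. Proof. by case: bal => _ _ []. Qed.
Let def_ae : CF_defined_ae mu. Proof. by case: bal. Qed.
Let lambda_ge0 n i : 0 <= lambda n i ord0. Proof. by case: CFm. Qed.

Let L n := \sum_(j < k) lambda n j ord0.
Let N n i : R := (#|` Fslice (base D n) i|)%:R.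

(** The entries are integers, and a zero entry would make the quotient 0, contrary to its positive
    limit. *)
Lemma rmx_eventually_ge1 :
  \forall n \near \oo, forall i j, 1 <= rmx D R n i j.
Proof.
have [_ _ _ _ [Lambda [_ rL _ L0]]] := bal.
have H i j : \forall n \near \oo, 1 <= rmx D R n i j.
  apply: filterS (cvgr_gt _ (rL i j) _ (L0 i)) => n.
  rewrite mxE ler1n lt0n; apply: contraTN => /eqP ->.
  by rewrite mul0r ltxx.
by apply: filter_forall => i; apply: filter_forall => j; exact: H.
Qed.

(** For [k > 1] the column has at least two entries that are at least 1; for [k = 1] its only entry
    exceeds 1 by [CF_card]. *)
Lemma column_sum_ge2 : \forall n \near \oo, forall j, 2 <= \sum_i rmx D R n.+1 i j.
Proof.
have [n0 _ Hn0] := rmx_eventually_ge1.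
exists n0 => // n /= n0n j; have r1 i := Hn0 n.+1 (leqW n0n) i j.
have [k1|k2] := leqP k 1; last first.
  apply: (@le_trans _ _ (\sum_(i < k) (1 : R))); last exact: ler_sum.
  by rewrite sumr_const card_ord ler_nat.
have j1 (i : 'I_k) : i = j.
  by apply: val_inj; have := ltn_ord i; have := ltn_ord j => /=; lia.
rewrite (bigD1 j)//= big1 ?addr0; last by move=> i; rewrite (j1 i) eqxx.
have := CF_card D j (ltn0Sn n); rewrite (bigD1 j)//= big1 ?addn0; last first.
  by move=> i; rewrite (j1 i) eqxx.
by rewrite mxE (ler_nat _ 2).
Qed.

(** [L n] is the sum of the [lambda n.+1 j ord0] weighted by column sums, so eventually it is at
    least twice [L n.+1]. *)
Lemma total_lambda_cvg0 : L @ \oo --> (0 : R).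
Proof.
apply: halving_cvg0; first by move=> n; exact: sumr_ge0.
apply: filterS column_sum_ge2 => n H.
have [_ _ lamE _] := CFm.
have -> : L n = \sum_j (\sum_i rmx D R n.+1 i j) * lambda n.+1 j ord0.
  rewrite /L; under eq_bigr do rewrite lamE mxE.
  by rewrite exchange_big /=; apply: eq_bigr => j _; rewrite mulr_suml.
rewrite /L mulr_sumr; apply: ler_sum => j _.
exact: ler_wpM2r.
Qed.

Lemma tower_mass_le1 n i : N n i * lambda n i ord0 <= 1.
Proof.
have := measure_Xlevel0 CFm n; rewrite X01 => -[->].
rewrite (bigD1 i)//= lerDl; apply: sumr_ge0 => j _.
by rewrite mulr_ge0.
Qed.

Lemma balanced_lower_bound : exists2 c : R, 0 < c & \forall n \near \oo, forall i,
  c <= N n i * lambda n i ord0 /\ c * L n <= lambda n i ord0.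
Proof.
have [_ _ _ [delta [/all_and2[d0 dcv] _]] [Lambda [lL _ _ L0]]] := bal.
have [c1 c10 c1d] := positive_lower_bound d0.
have [c2 c20 c2L] := positive_lower_bound L0.
pose c := Num.min c1 c2 / 2.
have m0 : 0 < Num.min c1 c2 by rewrite lt_min c10 c20.
have c0 : 0 < c by rewrite divr_gt0.
have cm : c < Num.min c1 c2 by rewrite /c ltr_pdivrMr// ltr_pMr// ltr1n.
exists c => //; apply: filter_forall => i.
have dcvi : (fun n => N n i * lambda n i ord0) @ \oo --> delta i.
  have := dcv i; move/fine_cvg; apply: cvg_trans; apply: near_eq_cvg.
  by apply: nearW => n /=; rewrite Xlevel0_slice (measure_base_slice CFm).
have Lcvi := lL i.
have cd : c < delta i.
  by apply: lt_le_trans cm _; rewrite ge_min c1d.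
have cL : c < Lambda i.
  by apply: lt_le_trans cm _; rewrite ge_min c2L orbT.
apply: filterS2 (cvgr_ge _ dcvi _ cd) (cvgr_ge _ Lcvi _ cL) => n h1 h2; split => //.
have L_ge0 : 0 <= L n by exact: sumr_ge0.
move: L_ge0; rewrite le_eqVlt => /predU1P[L00|Lpos].
  by rewrite -L00 mulr0.
by rewrite -ler_pdivlMr.
Qed.

(** With [i] the shortest tower and [a] the return total, [c ^+ 2] is at most the square of
    [N n i * lambda n i ord0], hence at most [2 * L n * a]. For any tower [j], the product
    [c * L n * N n j] is at most its mass in X_0, which is at most 1; combining the two and dividing
    by [L n] bounds [N n j]. *)
Lemma return_total_lower_bound : exists2 c : R, 0 < c & \forall n \near \oo,
  c <= 2 * L n * return_total mu n /\
  forall i, c * N n i <= 2 * return_total mu n.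
Proof.
have [c c0 H] := balanced_lower_bound.
(* The first estimate holds with [c ^+ 2], the second with [c ^+ 3]; this is the smaller of the
   two. *)
exists (c ^+ 3 * Num.min 1 c^-1).
  by rewrite mulr_gt0 ?exprn_gt0// lt_min invr_gt0 c0 ltr01.
apply: filterS H => n H.
have [i hE] := min_height_attained D n.
have := return_total_ge actT CFm X01 hE; rewrite -/(N n i) => a_ge.
have [dc _] := H i.
have a0 : 0 <= return_total mu n by apply: sumr_ge0 => m _; exact: fine_ge0.
have li0 := lambda_ge0 n i.
have lL : lambda n i ord0 <= L n.
  by rewrite /L (bigD1 i)//= lerDl; apply: sumr_ge0.
have N0 j : 0 <= N n j by exact: ler0n.
have key : c ^+ 2 <= 2 * L n * return_total mu n.
  apply: (@le_trans _ _ ((N n i * lambda n i ord0) ^+ 2)).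
    by rewrite ler_sqr ?nnegrE ?mulr_ge0// ltW.
  rewrite exprMn [X in _ * X]expr2 mulrA mulrC.
  apply: (@le_trans _ _ (lambda n i ord0 * (2 * return_total mu n))).
    by apply: ler_wpM2l => //; rewrite mulrC.
  by rewrite mulrCA mulrA ler_wpM2r// ler_wpM2l.
have Lpos : 0 < L n.
  apply: lt_le_trans lL; rewrite lt_def li0 andbT; apply/eqP => l0.
  by move: dc; rewrite l0 mulr0 leNgt c0.
split.
  apply: le_trans key; rewrite exprSr -mulrA ler_piMr ?exprn_ge0 ?(ltW c0)//.
  apply: (@le_trans _ _ (c * c^-1)); last by rewrite divff// gt_eqF.
  by rewrite ler_wpM2l ?(ltW c0)// ge_min lexx orbT.
move=> j; have [_ cLj] := H j.
have NcL : N n j * (c * L n) <= 1.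
  by apply: le_trans (tower_mass_le1 n j); rewrite ler_wpM2l.
rewrite -(ler_pM2r Lpos); apply: (@le_trans _ _ (c ^+ 3 * N n j * L n)).
  rewrite ler_wpM2r ?(ltW Lpos)// ler_wpM2r//.
  by rewrite ler_piMr ?exprn_ge0 ?(ltW c0)// ge_min lexx.
apply: le_trans (_ : c ^+ 2 * (N n j * (c * L n)) <= _).
  by rewrite le_eqVlt; apply/orP; left; apply/eqP; ring.
apply: (@le_trans _ _ (c ^+ 2)).
  by rewrite ler_piMr ?exprn_ge0 ?(ltW c0).
by rewrite mulrAC.
Qed.

Lemma return_total_cvgy : return_total mu @ \oo --> +oo.
Proof.
have [c c0 H] := return_total_lower_bound.
apply/cvgryPge => A.
pose B := Num.max A 1.
have B0 : 0 < B by rewrite lt_max ltr01 orbT.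
have e0 : 0 < c / (2 * B) by rewrite divr_gt0// mulr_gt0.
apply: filterS2 H (cvgr_lt _ total_lambda_cvg0 _ e0) => n [h _] Ln.
apply: (@le_trans _ _ B); first by rewrite le_max lexx.
rewrite leNgt; apply/negP => aB.
have L_ge0 : 0 <= L n by exact: sumr_ge0.
move: h; rewrite leNgt; apply/negP/negPn.
apply: (@le_lt_trans _ _ (2 * L n * B)).
  by rewrite ler_wpM2l ?mulr_ge0// ltW.
by move: Ln; rewrite ltr_pdivlMr ?mulr_gt0// mulrCA mulrA.
Qed.

Lemma balanced_bounded_returns :
  exists M, bounded_returns mu (CFact D) (Xlevel D 0) (min_height D)
    (return_total mu) M.
Proof.
have [c c0 H] := return_total_lower_bound.
(* One factor 2 comes from the two towers met by an orbit segment, the other from the bound of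
   [N n j] by [2 / c] times the return total. *)
exists (4 / c); split => //.
- exact: measurable_Xlevel0.
- exact: return_total_cvgy.
apply: filterS H => n [_ H].
have [_ _ _ TD] := actT.
have := ae_forall_countable (fun gh : int * int => TD gh.1 gh.2).
apply: filterS => x xD.
have [|j jE] := @bigop.eq_bigmax 'I_k (fun j => #|` Fslice (base D n) j|).
  by rewrite card_ord; exact: (CF_k_gt0 D).
have Hj i : (#|` Fslice (base D n) i| <= #|` Fslice (base D n) j|)%N.
  by rewrite -jE; exact: bigop.leq_bigmax.
apply: le_trans (@visits_bound _ _ _ (fun g h => xD (g, h)) R _ _ Hj) _.
rewrite -muln2 natrM -[4 / c]mulrC -mulrA ler_pdivlMl//.
by have := H j; rewrite /N => {}Hj; lra.
Qed.

End balanced_returns.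

(** * Rational ergodicity and non-squashability *)

(** The definition of subsequence weak rational ergodicity asks for strictly increasing times. The
    heights are unbounded because they dominate the return totals, so such times can be selected. *)
Lemma increasing_subsequence (R : realType) (h : nat -> nat) (a : nat -> R) :
  a @ \oo --> +oo -> (forall l, a l <= (h l)%:R) ->
  exists2 phi : nat -> nat, {homo h \o phi : m n / (m < n)%N} &
    phi @ \oo --> \oo.
Proof.
move=> aoo ah.
have nxt n : exists l, (n < l)%N /\ (h n < h l)%N.
  have [N _ HN] := (cvgryPgt _).1 aoo (h n)%:R.
  exists (maxn N n.+1); split; first by rewrite leq_max ltnSn orbT.
  rewrite -(ltr_nat R); apply: lt_le_trans (ah _).
  by apply: HN; rewrite /= leq_maxl.
have [f Hf] := choice nxt.
exists (fun n => iter n f 0%N).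
  apply: homo_ltn; first exact: ltn_trans.
  by move=> n /=; have [_] := Hf (iter n f 0%N).
have fge n : (n <= iter n f 0%N)%N.
  by elim: n => //= n IH; have [+ _] := Hf (iter n f 0%N); exact: leq_ltn_trans.
move=> A [N _ HN]; exists N => // n /= Nn; apply: HN => /=.
exact: leq_trans Nn (fge n).
Qed.

Section balanced_conclusion.
Context (R : realType) (k : nat) (D : CF_data k)
  (mu : {measure set (CFborel D) -> \bar R}) (lambda : nat -> 'cV[R]_k).
Context (bal : balanced_CF mu lambda) (inf : ergodic_infinite_mp mu (CFact D)).

Let actT : measure_preserving_action mu (CFact D). Proof. by case: inf. Qed.
Let ergT : ergodic_on mu setT (CFact D 1). Proof. by case: inf. Qed.
Let def_ae : CF_defined_ae mu. Proof. by case: bal. Qed.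
Let X01 : mu (Xlevel D 0) = 1%E. Proof. by case: bal => _ _ []. Qed.

Lemma return_sum_preimage (A B : set (CFborel D)) n :
  measurable A -> measurable B -> return_sum mu (CFact D) A B n =
  \sum_(0 <= m < n) fine (mu (A `&` CFact D (- m%:Z) @^-1` B)).
Proof.
move=> mA mB; apply: eq_bigr => m _; congr fine.
exact: measure_CFact_image.
Qed.

Lemma return_sum_total l :
  return_sum mu (CFact D) (Xlevel D 0) (Xlevel D 0) (min_height D l) =
  return_total mu l.
Proof.
have mX := @measurable_Xlevel0 k D; have [mT pT T0 TD] := actT.
have pre g (A : set (CFborel D)) : measurable A ->
    measurable ((CFact D g : CFborel D -> CFborel D) @^-1` A).
  by move=> mA; rewrite -[X in measurable X]setTI; exact: mT.
rewrite return_sum_preimage//; apply: eq_bigr => m _; congr fine.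
rewrite -(pT m%:Z); last by apply: measurableI => //; exact: pre.
apply: measure_ae_eq.
- by apply: (pre); apply: measurableI => //; exact: pre.
- by apply: measurableI => //; exact: pre.
- apply: filterS2 (TD (- m%:Z) m%:Z) T0 => x; rewrite addNr => E x0.
  by rewrite /preimage /setI /= -E x0; tauto.
Qed.

Lemma return_total_le l : return_total mu l <= (min_height D l)%:R.
Proof.
have mX := @measurable_Xlevel0 k D; have [mT _ _ _] := actT.
rewrite -[min_height D l in leRHS]subn0 -sumr_const_nat; apply: ler_sum => m _.
have mXX : measurable
    (Xlevel D 0 `&` CFact D m%:Z @^-1` Xlevel D 0 : set (CFborel D)).
  apply: measurableI => //; rewrite -[X in measurable X]setTI; exact: mT.
have le1 : (mu (Xlevel D 0 `&` CFact D m%:Z @^-1` Xlevel D 0) <= 1%:E)%E.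
  by rewrite -X01; apply: le_measure; rewrite ?inE//.
rewrite -lee_fin fineK// ge0_fin_numE//.
by apply: le_lt_trans le1 _; rewrite ltry.
Qed.

Lemma balanced_returns_limit (A B : set (CFborel D)) :
  measurable A -> measurable B -> A `<=` Xlevel D 0 -> B `<=` Xlevel D 0 ->
  (fun l => return_sum mu (CFact D) A B (min_height D l) /
    return_sum mu (CFact D) (Xlevel D 0) (Xlevel D 0) (min_height D l))
    @ \oo --> fine (mu A) * fine (mu B).
Proof.
move=> mA mB AX BX; have [M bT] := balanced_bounded_returns bal actT.
have H := returns_limit actT ergT bT mA mB AX BX.
under eq_fun do rewrite return_sum_total return_sum_preimage//.
exact: H.
Qed.

Lemma balanced_subseq_weakly_rationally_ergodic :
  subseq_weakly_rationally_ergodic mu (CFact D).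
Proof.
have [M [mX _ aoo _ _]] := balanced_bounded_returns bal actT.
have [phi hphi phioo] := increasing_subsequence aoo return_total_le.
exists (min_height D \o phi), (Xlevel D 0); split => //.
  by rewrite X01 lte01 ltry.
move=> A B mA mB AX BX; have H := balanced_returns_limit mA mB AX BX.
have {}H := cvg_comp _ _ phioo H.
under eq_fun do rewrite /= X01 /= expr1n divr1 mulrC.
exact: H.
Qed.

End balanced_conclusion.

(** Invariance of [mu] under the (C,F)-action is deduced from that of [nu] through the isomorphism.
    The bounded returns to X_0 are then pulled back to [Y], where the non-squashability argument is
    carried out. *)
Lemma balanced_finite_rank_non_squashable (R : realType) d (Y : measurableType d)
    (nu : {measure set Y -> \bar R}) (T : int -> Y -> Y) :
  ergodic_infinite_mp nu T -> balanced_finite_rank nu T -> non_squashable nu T.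
Proof.
move=> [actT ergT _] [k [D [mu [lambda [bal iso]]]]].
have [phi [psi [[mphi mpsi] _ _ pphi comm]]] := iso.
have [_ def_ae _ _ _] := bal; have [mT pT _ _] := actT.
have pre dd dd' (W : measurableType dd) (W' : measurableType dd') (f : W -> W') A :
    measurable_fun setT f -> measurable A -> measurable (f @^-1` A).
  by move=> mf mA; rewrite -[X in measurable X]setTI; exact: mf.
have act : measure_preserving_action mu (CFact D).
  apply: CFact_preserving => // g A mA.
  have mgA : measurable ((CFact D g : CFborel D -> CFborel D) @^-1` A).
    by apply: (pre) => //; exact: measurable_CFact.
  rewrite -(pphi _ mgA) -(pphi _ mA) -(pT g (phi @^-1` A)); last exact: pre.
  apply: measure_ae_eq.
  - exact: pre.
  - by apply: (pre) => //; exact: pre.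
  - by apply: filterS (comm g) => y cy; rewrite /preimage /= cy.
have [M bT] := balanced_bounded_returns bal act.
apply: (bounded_returns_non_squashable actT ergT).
apply: (bounded_returns_factor mphi pphi comm mT _ bT).
by move=> g; exact: measurable_CFact.
Qed.

Theorem theorem5p5 (R : realType) :
  (forall (k : nat) (D : CF_data k) (mu : {measure set (CFborel D) -> \bar R})
      (lambda : nat -> 'cV[R]_k),
    balanced_CF mu lambda ->
    ergodic_infinite_mp mu (CFact D) ->
    (forall A B : set (CFborel D), measurable A -> measurable B ->
      A `<=` Xlevel D 0 -> B `<=` Xlevel D 0 ->
      (fun l => return_sum mu (CFact D) A B (min_height D l) /
        return_sum mu (CFact D) (Xlevel D 0) (Xlevel D 0) (min_height D l))
        @ \oo --> fine (mu A) * fine (mu B)) /\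
    subseq_weakly_rationally_ergodic mu (CFact D)) /\
  (forall (d : measure_display) (Y : measurableType d)
      (nu : {measure set Y -> \bar R}) (T : int -> Y -> Y),
    ergodic_infinite_mp nu T -> balanced_finite_rank nu T ->
    non_squashable nu T).
Proof.
split=> [k D mu lambda bal inf|d Y nu T]; last first.
  exact: balanced_finite_rank_non_squashable.
split=> [A B|]; first exact: (balanced_returns_limit bal inf).
exact: (balanced_subseq_weakly_rationally_ergodic bal inf).
Qed.
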